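(* For each $n\ge p$ let $\mathbf Y=\mathbf X\boldsymbol\beta^0+\boldsymbol\epsilon$ with $\boldsymbol\epsilon\sim N_n(\mathbf 0,\sigma^2\mathbf I_n)$, $\sigma>0$ fixed and known, where $\mathbf X=\mathbf X^{(n)}$ is $n\times p$ with $\mathbf X^T\mathbf X=n\mathbf I_p$ and $\boldsymbol\beta^0=(\boldsymbol\beta^0_1,\dots,\boldsymbol\beta^0_G)$ (blocks of fixed sizes $m_g$, $p=\sum_gm_g$) does not depend on $n$. Put independent priors $\boldsymbol\beta_g\sim(1-\pi_0)N_{m_g}(\mathbf 0,\sigma^2\tau_{g,n}^2\mathbf I_{m_g})+\pi_0\delta_{\mathbf 0}(\boldsymbol\beta_g)$, $g=1,\dots,G$, with fixed $\pi_0\in(0,1)$ and fixed (non-random) $\tau^2_{g,n}>0$, and let $\hat{\boldsymbol\beta}^{Med}$ be the vector of coordinatewise marginal posterior medians, $\hat\beta^{Med}_{gj}=\mathrm{Med}(\beta_{gj}\mid\mathbf Y,\mathbf X)$. Suppose that for every $g$, $\sqrt n\,\tau^2_{g,n}\to\infty$ and $\log(\tau^2_{g,n})/n\to0$ as $n\to\infty$. Then: (i) (selection consistency) $\lim_{n\to\infty}P(\mathcal A_n^{Med}=\mathcal A)=1$; (ii) (asymptotic normality) $\sqrt n\big(\hat{\boldsymbol\beta}^{Med}_{\mathcal A}-\boldsymbol\beta^0_{\mathcal A}\big)\xrightarrow{d}N(\mathbf 0,\sigma^2\mathbf I)$.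
   Context: $\delta_{\mathbf 0}$ is a point mass at the zero vector. $\mathcal A=(I(\|\boldsymbol\beta_g^0\|_2\ne0))_{g=1}^G$ is the index vector of the true model, and $\mathcal A_n^{Med}=(I(\|\hat{\boldsymbol\beta}^{Med}_g\|_2\ne0))_{g=1}^G$ that of the model selected by the posterior median. For a vector $\mathbf v=(\mathbf v_1,\dots,\mathbf v_G)$, $\mathbf v_{\mathcal A}$ denotes the subvector consisting of the blocks $\mathbf v_g$ with $\boldsymbol\beta^0_g\neq\mathbf 0$. *)

(* Defs.v *)
From HB Require Import structures.
From mathcomp Require Import all_boot all_order all_algebra.
From mathcomp Require Import all_classical all_reals all_analysis.
Set Implicit Arguments. Unset Strict Implicit. Unset Printing Implicit Defensive.
Import Order.TTheory GRing.Theory Num.Theory.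
Import numFieldNormedType.Exports.
Local Open Scope classical_set_scope.
Local Open Scope ring_scope.

Definition gcoord (G : nat) (m : 'I_G -> nat) : finType := {g : 'I_G & 'I_(m g)}.
Arguments gcoord : clear implicits.

Section defs.
Context {R : realType}.

Fixpoint gauss_iter {I : eqType} (s : R) (l : seq I)
    (h : (I -> R) -> \bar R) (v : I -> R) : \bar R :=
  match l with
  | [::] => h v
  | k :: l' => (\int[normal_prob 0 s]_x
                  gauss_iter s l' h (fun i => if i == k then x else v i))%E
  end.

Definition gauss_exp (I : finType) (s : R) (h : (I -> R) -> \bar R) : \bar R :=
  gauss_iter s (enum I) h (fun _ => 0).

Definition iid_normal {d} {T : measurableType d} (P : probability T R)
    (I : finType) (Z : I -> T -> R) (s : R) : Prop :=
  (forall i, measurable_fun setT (Z i)) /\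
  (forall i (A : set R), measurable A -> P (Z i @^-1` A) = normal_prob 0 s A) /\
  (forall A : I -> set R, (forall i, measurable (A i)) ->
     P (\bigcap_(i in [set: I]) (Z i @^-1` A i)) =
     (\prod_(i : I) P (Z i @^-1` A i))%E).
End defs.

Section model.
Context {R : realType} (G : nat) (m : 'I_G -> nat).
Local Notation I := (gcoord G m).

Definition grp_active (b : I -> R) (g : 'I_G) : bool :=
  [exists k : I, (tag k == g) && (b k != 0)].

(* Expectation of h(beta) under the independent spike-and-slab prior
   beta_g ~ (1-pi0) N_{m_g}(0, sigma^2 tau2_g I) + pi0 delta_0, written as the
   mixture over the set S of groups drawn from the slab. *)
Definition prior_exp (sigma pi0 : R) (tau2 : 'I_G -> R)
    (h : (I -> R) -> \bar R) : \bar R :=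
  (\sum_(S : {set 'I_G})
     ((1 - pi0) ^+ #|S| * pi0 ^+ (G - #|S|))%:E *
     gauss_exp 1 (fun z : I -> R =>
       h (fun k => if tag k \in S then (sigma * Num.sqrt (tau2 (tag k)) * z k)%R
                   else 0%R)))%E.

Definition lik (n : nat) (X : 'I_n -> I -> R) (sigma : R) (y : 'I_n -> R)
    (b : I -> R) : R :=
  expR (- (\sum_(i < n) (y i - \sum_(k : I) X i k * b k) ^+ 2) / (sigma ^+ 2 *+ 2)).

Definition post_cdf (n : nat) (X : 'I_n -> I -> R) (sigma pi0 : R)
    (tau2 : 'I_G -> R) (y : 'I_n -> R) (k : I) (t : R) : R :=
  fine (prior_exp sigma pi0 tau2
          (fun b => (((b k <= t)%R)%:R * lik X sigma y b)%:E)) /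
  fine (prior_exp sigma pi0 tau2 (fun b => (lik X sigma y b)%:E)).

Definition post_med (n : nat) (X : 'I_n -> I -> R) (sigma pi0 : R)
    (tau2 : 'I_G -> R) (y : 'I_n -> R) (k : I) : R :=
  inf [set t | 2^-1 <= post_cdf X sigma pi0 tau2 y k t].

End model.

(* Main.v *)
(* Because X^T X = n I, the likelihood factors over the coordinates of beta and
   depends on Y only through X^T Y = n beta^0 + sqrt n W, with
   W = n^(-1/2) X^T eps.  Hence the marginal posterior of a coordinate is an
   explicit mixture of a normal law and a point mass at 0, and the posterior
   median is a deterministic function psi_n of W.  By rotation invariance W is
   iid N(0, sigma^2) for every n, so its law does not depend on n, and it is
   enough to study psi_n(z) for a fixed vector z: the posterior weight of the
   null model tends to 1 on the inactive groups, because n tau^2 -> oo, and to 0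
   on the active ones, because log tau^2 = o(n), while the shrinkage bias of the
   slab mean, multiplied by sqrt n, is O(sqrt n / (1 + n tau^2)) = o(1).  Both
   claims follow by dominated convergence under the fixed law
   of W. *)

Require Import Defs.
From HB Require Import structures.
From mathcomp Require Import all_boot all_order all_algebra.
From mathcomp Require Import all_classical all_reals all_analysis.
From mathcomp Require Import measurable_realfun ring lra.
Set Implicit Arguments. Unset Strict Implicit. Unset Printing Implicit Defensive.
Import Order.TTheory GRing.Theory Num.Theory.
Import numFieldNormedType.Exports.
Local Open Scope classical_set_scope.
Local Open Scope ring_scope.

(** * Normal measures *)

(** Rotation invariance is derived from one-dimensional facts alone: shears reduce to translations
    under Tonelli, a plane rotation is a product of shears, and an array with orthonormal rows
    becomes, after plane rotations and sign flips of its columns, a selection of distinct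
    coordinates. Nothing relates the noise vectors for different [n], so [W] itself need not
    converge. Only expectations of bounded measurable functions of it are transferred, all to one
    fixed index [N]. This is why measurability of the median in the score, and of a continuous [f]
    for the sigma-algebra generated by boxes, has to be proved. The two halves of selection
    consistency rest on different mechanisms. On an inactive group a null weight above one half
    makes every coordinate median exactly zero. On an active group a vanishing null weight does not
    by itself exclude a zero median; there the rate [sqrt n] is used, since a zero at a coordinate
    with [beta0 k != 0] would make the scaled error unbounded. Coordinates of an active group with
    zero true value are covered by the same convergence. *)

Section normal_facts.
Context {R : realType}.
Notation mu := (@lebesgue_measure R).

(** Both sides are measures in [A], so uniqueness of Lebesgue measure reduces the claim to half-open
    intervals, whose preimages have length [(v - u) / s]. *)
Lemma lebesgue_measure_affine (a s : R) (A : set R) : 0 < s -> measurable A ->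
  (mu A = s%:E * mu ((fun x => a + s * x)%R @^-1` A))%E.
Proof.
move=> s0 mA.
have mf : measurable_fun setT (fun x : measurableTypeR R => (a + s * x)%R : measurableTypeR R).
  by apply: measurable_funD => //; apply: measurable_funM.
pose phi : {mfun measurableTypeR R >-> measurableTypeR R} :=
  HB.pack (fun x : measurableTypeR R => (a + s * x)%R : measurableTypeR R)
    (isMeasurableFun.Build _ _ _ _ _ mf).
pose sn := NngNum (ltW s0).
apply: (@lebesgue_measure_unique R (mscale sn (pushforward mu phi))) => //.
move=> _ [[u v]] _ <-; have phiE : (fun x => a + s * x)%R @^-1` `]u, v]%classic = `](u - a) / s, (v - a) / s]%classic.
  apply/seteqP; split => x /=; rewrite !in_itv /= ltr_pdivrMr// ler_pdivlMr// ltrBlDl lerBrDl (mulrC x)//.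
rewrite [RHS](_ : _ = (s%:E * mu [set` `](u - a) / s, (v - a) / s]%R])%E); last first.
  by rewrite /mscale /= /pushforward; congr (_ * mu _)%E.
rewrite !lebesgue_measure_itv /= !lte_fin.
rewrite ltr_pM2r ?invr_gt0// ltrD2r; case: ifP => _; last by rewrite mule0.
rewrite -!EFinB -EFinM; congr EFin; field; exact: lt0r_neq0.
Qed.

Lemma ge0_integral_affine (a s : R) (f : R -> \bar R) : 0 < s ->
  measurable_fun setT f -> (forall x, 0 <= f x)%E ->
  (\int[mu]_x f x = s%:E * \int[mu]_x f (a + s * x)%R)%E.
Proof.
move=> s0 mf f0.
have mphi : measurable_fun setT (fun x : measurableTypeR R => (a + s * x)%R : measurableTypeR R).
  by apply: measurable_funD => //; apply: measurable_funM.
pose phi : {mfun measurableTypeR R >-> measurableTypeR R} :=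
  HB.pack (fun x : measurableTypeR R => (a + s * x)%R : measurableTypeR R)
    (isMeasurableFun.Build _ _ _ _ _ mphi).
pose sn := NngNum (ltW s0).
rewrite (_ : \int[mu]_x f (a + s * x)%R = \int[mu]_(x in phi @^-1` setT) (f \o phi) x)%E//.
rewrite -ge0_integral_pushforward//.
rewrite -[s]/(sn%:num) -ge0_integral_mscale//.
apply: eq_measure_integral => A mA _.
exact: lebesgue_measure_affine.
Qed.

Lemma ge0_integral_opp (f : R -> \bar R) :
  measurable_fun setT f -> (forall x, 0 <= f x)%E ->
  (\int[mu]_x f x = \int[mu]_x f (- x)%R)%E.
Proof.
move=> mf f0.
rewrite (_ : \int[mu]_x f (- x)%R =
  \int[mu]_(x in (-%R : _ -> measurableTypeR R) @^-1` setT) (f \o -%R) x)%E//.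
rewrite -ge0_integral_pushforward//.
by apply: eq_measure_integral => A mA _; exact/esym/lebesgue_measureN.
Qed.

(** The Radon-Nikodym derivative and [normal_pdf] have the same integral over every measurable set,
    hence agree almost everywhere. *)
Lemma ge0_integral_normal_prob (m s : R) (f : R -> \bar R) :
  measurable_fun setT f -> (forall x, 0 <= f x)%E ->
  (\int[normal_prob m s]_x f x = \int[mu]_x (f x * (normal_pdf m s x)%:E))%E.
Proof.
move=> mf f0.
rewrite -(Radon_Nikodym_SigmaFinite.change_of_variables (normal_prob_dominates m s))//.
have nd := normal_prob_dominates m s.
have irn := @Radon_Nikodym_SigmaFinite.f_integrable _ _ _ (normal_prob m s) mu nd.
apply: ae_eq_integral => //.
- by apply: emeasurable_funM => //; exact: measurable_int irn.
- by apply: emeasurable_funM => //; apply/measurable_EFinP; exact: measurable_normal_pdf.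
- apply: ae_eqe_mul2l.
  apply: integral_ae_eq => //.
  + by apply/measurable_EFinP; exact: measurable_normal_pdf.
  + by move=> A _ mA; rewrite -Radon_Nikodym_SigmaFinite.f_integral.
Qed.

Lemma normal_prob_integral (m s : R) (A : set R) : measurable A ->
  (normal_prob m s A = \int[mu]_x ((\1_A x)%:E * (normal_pdf m s x)%:E))%E.
Proof.
move=> mA; rewrite /normal_prob integral_mkcond; apply: eq_integral => x _.
rewrite patchE indicE; case: ifPn => _; first by rewrite mul1e.
by rewrite mul0e.
Qed.

Lemma measurable_indic_normal_pdf (A : set R) m s : measurable A ->
  measurable_fun setT (fun x => (\1_A x)%:E * (normal_pdf m s x)%:E)%E.
Proof.
move=> mA; apply: emeasurable_funM; apply/measurable_EFinP => //.
exact: measurable_normal_pdf.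
Qed.

Lemma indic_normal_pdf_ge0 (A : set R) m s x :
  (0 <= (\1_A x)%:E * (normal_pdf m s x)%:E)%E.
Proof. by rewrite mule_ge0// lee_fin ?normal_pdf_ge0. Qed.

Lemma normal_prob_standard (m s : R) (A : set R) : 0 < s -> measurable A ->
  normal_prob m s A = normal_prob 0 1 ((fun x => m + s * x) @^-1` A).
Proof.
move=> s0 mA.
rewrite normal_prob_integral// (@ge0_integral_affine m s)//; first last.
- by move=> x; exact: indic_normal_pdf_ge0.
- exact: measurable_indic_normal_pdf.
have mA' : measurable ((fun x : R => m + s * x) @^-1` A).
  rewrite -[X in measurable X]setTI.
  have : measurable_fun setT (fun x : R => m + s * x).
    by apply: measurable_funD => //; apply: measurable_funM.
  exact.
rewrite normal_prob_integral// -ge0_integralZl//; last 3 first.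
- apply: (@measurableT_comp _ _ _ _ _ _ (fun x => (\1_A x)%:E * (normal_pdf m s x)%:E)%E).
    exact: measurable_indic_normal_pdf.
  by apply: measurable_funD => //; apply: measurable_funM.
- by move=> x _; exact: indic_normal_pdf_ge0.
- by rewrite lee_fin ltW.
apply: eq_integral => x _; rewrite muleCA; congr (_ * _)%E.
rewrite -EFinM; congr EFin.
rewrite !normal_pdfE ?gt_eqF// /normal_peak /normal_fun.
rewrite mulrA; congr (_ * expR _); last first.
  rewrite addrAC subrr add0r subr0 expr1n -mulr_natr -[in RHS]mulr_natr.
  by field; exact: lt0r_neq0.
rewrite -!mulrnAr sqrtrM ?sqr_ge0// sqrtr_sqr gtr0_norm// expr1n mul1r.
have sp : Num.sqrt (pi *+ 2) != 0 :> R by rewrite gt_eqF// sqrtr_gt0 mulrn_wgt0// pi_gt0.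
by field; rewrite sp lt0r_neq0.
Qed.

Lemma normal_pdf_opp (s x : R) : 0 < s -> normal_pdf 0 s (- x) = normal_pdf 0 s x.
Proof. by move=> s0; rewrite !normal_pdfE ?gt_eqF// /normal_fun !subr0 sqrrN. Qed.

Lemma normal_prob_opp (s : R) (A : set R) : 0 < s -> measurable A ->
  normal_prob 0 s (-%R @^-1` A) = normal_prob 0 s A.
Proof.
move=> s0 mA.
have mA' : measurable ((-%R : R -> R) @^-1` A).
  rewrite -[X in measurable X]setTI.
  have : measurable_fun setT (-%R : R -> R) by [].
  exact.
rewrite !normal_prob_integral// [RHS]ge0_integral_opp; first last.
- by move=> x; exact: indic_normal_pdf_ge0.
- exact: measurable_indic_normal_pdf.
by apply: eq_integral => x _; rewrite normal_pdf_opp.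
Qed.

End normal_facts.

(** * Rotation invariance of the planar normal law *)

Section rotation.
Context {R : realType}.
Notation mu := (@lebesgue_measure R).
Notation RR := (measurableTypeR R * measurableTypeR R)%type.

(** Tonelli makes [x] the inner variable; for fixed [y] the shear is then a translation. *)
Lemma ge0_integral_shear1 (a : R) (F : RR -> \bar R) :
  measurable_fun setT F -> (forall z, 0 <= F z)%E ->
  (\int[mu]_x \int[mu]_y F (x + a * y, y)%R = \int[mu]_x \int[mu]_y F (x, y))%E.
Proof.
move=> mF F0.
have msh : measurable_fun setT (fun z : RR => (z.1 + a * z.2, z.2)%R : RR).
  apply: measurable_fun_pair => //; apply: measurable_funD => //.
  by apply: measurable_funM.
have mG : measurable_fun setT (fun z : RR => F (z.1 + a * z.2, z.2)%R).
  exact: (measurableT_comp mF msh).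
apply: etrans (fubini_tonelli _ mG _) _ => [z|]; first exact: F0.
apply: etrans (esym (fubini_tonelli _ mF F0)).
apply: eq_integral => y _ /=.
apply: esym; apply: etrans (@ge0_integral_affine R (a * y) 1 (fun x => F (x, y)) _ _ _) _ => //.
  exact: (measurableT_comp mF (measurable_pair2 y)).
by rewrite mul1e; apply: eq_integral => x _; rewrite mul1r addrC.
Qed.

Lemma ge0_integral_shear2 (b : R) (F : RR -> \bar R) :
  measurable_fun setT F -> (forall z, 0 <= F z)%E ->
  (\int[mu]_x \int[mu]_y F (x, y + b * x)%R = \int[mu]_x \int[mu]_y F (x, y))%E.
Proof.
move=> mF F0; apply: eq_integral => x _.
rewrite [RHS](@ge0_integral_affine R (b * x) 1)//; last first.
  exact: (measurableT_comp mF (measurable_pair1 x)).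
by rewrite mul1e; apply: eq_integral => y _; rewrite mul1r addrC.
Qed.

(* A rotation is a product of three shears, each of which preserves area. *)
Lemma ge0_integral_rotation (c t : R) (F : RR -> \bar R) :
  c ^+ 2 + t ^+ 2 = 1 -> t != 0 ->
  measurable_fun setT F -> (forall z, 0 <= F z)%E ->
  (\int[mu]_x \int[mu]_y F (c * x + t * y, - t * x + c * y)%R =
   \int[mu]_x \int[mu]_y F (x, y))%E.
Proof.
(* With [c] the cosine and [t] the sine of the angle, [a] is the tangent of half the angle; the
   three shears have coefficients [a], [- t], [a]. *)
move=> ct t0 mF F0; pose a := (1 - c) / t.
pose F2 (z : RR) := F (z.1 + a * z.2, z.2)%R.
pose F1 (z : RR) := F2 (z.1, z.2 + (- t) * z.1)%R.
have mF2 : measurable_fun setT F2.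
  apply: (measurableT_comp mF); apply: measurable_fun_pair => //.
  by apply: measurable_funD => //; apply: measurable_funM.
have mF1 : measurable_fun setT F1.
  apply: (measurableT_comp mF2); apply: measurable_fun_pair => //.
  by apply: measurable_funD => //; apply: measurable_funM.
have e1 := ge0_integral_shear1 a mF F0.
have e2 := @ge0_integral_shear2 (- t) F2 mF2 (fun z => F0 _).
have e3 := @ge0_integral_shear1 a F1 mF1 (fun z => F0 _).
apply: etrans e1; apply: etrans e2; apply: etrans e3.
apply: eq_integral => x _; apply: eq_integral => y _.
have ta : t * a = 1 - c by rewrite /a; field.
rewrite /F1 /F2 /=; congr (F (_, _)); last by ring: ta.
have tE : t = a * (1 + c) by apply: (mulIf t0); rewrite mulrAC (mulrC a) ta; lra.
have acE : a * a * (1 + c) = 1 - c by rewrite -mulrA -tE mulrC.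
transitivity (x + a * y + a * y - (a * a * (1 + c)) * (x + a * y)).
  by rewrite acE tE; ring.
by rewrite tE; ring.
Qed.

(** Puts the planar law in the form of a double Lebesgue integral, on which the area-preserving
    change of variables acts. *)
Lemma product_normal_prob_integral (s : R) (C : set RR) : measurable C ->
  ((normal_prob 0 s \x normal_prob 0 s) C = \int[mu]_x \int[mu]_y
    ((\1_C (x, y))%:E * (normal_pdf 0 s x * normal_pdf 0 s y)%:E))%E.
Proof.
move=> mC.
have mI : measurable_fun setT (fun z : RR => (\1_C z)%:E : \bar R).
  by apply/measurable_EFinP.
have I0 (z : RR) : (0 <= (\1_C z)%:E :> \bar R)%E by rewrite lee_fin indicE.
pose F (x : R) := (\int[normal_prob 0 s]_y (\1_C (x, y))%:E)%E.
have mF : measurable_fun setT F.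
  exact: (measurable_fun_fubini_tonelli_F (m2 := normal_prob 0 s) _ mI I0).
have F0 x : (0 <= F x)%E by apply: integral_ge0 => y _; exact: I0.
transitivity (\int[normal_prob 0 s \x normal_prob 0 s]_z (\1_C z)%:E)%E.
  by rewrite integral_indic// setIT.
apply: etrans (fubini_tonelli1 _ mI I0) _.
apply: etrans (ge0_integral_normal_prob 0 s mF F0) _.
rewrite /F.
apply: eq_integral => x _.
have mIx : measurable_fun setT (fun y : R => (\1_C (x, y))%:E : \bar R).
  exact: (measurableT_comp mI (measurable_pair1 x)).
rewrite ge0_integral_normal_prob//.
rewrite -ge0_integralZr//.
- by apply: eq_integral => y _; rewrite -muleA -EFinM (mulrC (normal_pdf 0 s y)).
- apply: emeasurable_funM => //; apply/measurable_EFinP; exact: measurable_normal_pdf.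
- by move=> y _; rewrite mule_ge0// lee_fin ?indicE ?normal_pdf_ge0.
- by rewrite lee_fin normal_pdf_ge0.
Qed.

Lemma normal_pdf_rotation (s c t x y : R) : 0 < s -> c ^+ 2 + t ^+ 2 = 1 ->
  normal_pdf 0 s (c * x + t * y) * normal_pdf 0 s (- t * x + c * y) =
  normal_pdf 0 s x * normal_pdf 0 s y.
Proof.
move=> s0 ct; rewrite !normal_pdfE ?gt_eqF// /normal_fun.
rewrite mulrACA [RHS]mulrACA; congr (_ * _).
rewrite -!expRD; congr expR; rewrite -!mulrDl; congr (_ / _).
rewrite !subr0 -!opprD; congr (- _).
transitivity ((c ^+ 2 + t ^+ 2) * (x ^+ 2 + y ^+ 2)); first by ring.
by rewrite ct mul1r.
Qed.

Definition rot (c t : R) (z : RR) : RR := (c * z.1 + t * z.2, - t * z.1 + c * z.2).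

Lemma measurable_rot c t : measurable_fun setT (rot c t).
Proof.
by apply: measurable_fun_pair; apply: measurable_funD; apply: measurable_funM.
Qed.

(** The joint density depends on [x ^+ 2 + y ^+ 2] only, and the rotation preserves area. *)
Lemma product_normal_rotation (s c t : R) (A B : set R) :
  0 < s -> c ^+ 2 + t ^+ 2 = 1 -> t != 0 -> measurable A -> measurable B ->
  ((normal_prob 0 s \x normal_prob 0 s) (rot c t @^-1` (A `*` B)) =
   normal_prob 0 s A * normal_prob 0 s B)%E.
Proof.
move=> s0 ct t0 mA mB.
have mAB : measurable (A `*` B : set RR) by exact: measurableX.
have mP : measurable (rot c t @^-1` (A `*` B)).
  by rewrite -[X in measurable X]setTI; exact: measurable_rot.
pose G (z : RR) := ((\1_(A `*` B) z)%:E *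
  (normal_pdf 0 s z.1 * normal_pdf 0 s z.2)%:E)%E.
have mG : measurable_fun setT G.
  apply: emeasurable_funM; apply/measurable_EFinP => //.
  by apply: measurable_funM; apply: measurableT_comp => //; exact: measurable_normal_pdf.
have G0 z : (0 <= G z)%E.
  by rewrite mule_ge0// lee_fin ?indicE ?mulr_ge0 ?normal_pdf_ge0.
apply: etrans (product_normal_prob_integral s mP) _.
apply: etrans (product_measure1E (normal_prob 0 s) (normal_prob 0 s) mA mB).
apply: etrans (esym (product_normal_prob_integral s mAB)).
apply: etrans (ge0_integral_rotation ct t0 mG G0).
apply: eq_integral => x _; apply: eq_integral => y _.
by rewrite /G /= normal_pdf_rotation.
Qed.

End rotation.

(** * Orthonormal transforms of iid normal vectors *)

(** A Givens rotation. The values are functions on an arbitrary [T], so that the same definition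
    acts on random variables and on the columns of an array. *)
Definition plane_rot {R : realType} {T : Type} (I : eqType) (i j : I) (c t : R)
    (Z : I -> T -> R) (k : I) (w : T) : R :=
  if k == i then c * Z i w + t * Z j w
  else if k == j then - t * Z i w + c * Z j w else Z k w.

Section iid.
Context {R : realType} {d : measure_display} {T : measurableType d}.
Variable P : probability T R.

(** Taking all sides but one to be the whole line recovers the marginals, and then independence. The
    box form is the one that is easy to transform. *)
Lemma iid_normal_box (I : finType) (Z : I -> T -> R) (s : R) :
  iid_normal P Z s <-> (forall i, measurable_fun setT (Z i)) /\
  (forall A : I -> set R, (forall i, measurable (A i)) ->
     P (\bigcap_(i in [set: I]) (Z i @^-1` A i)) =
     (\prod_(i : I) normal_prob 0 s (A i))%E).
Proof.
split=> [[mZ [nZ iZ]]|[mZ bZ]]; split => //.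
  by move=> A mA; rewrite iZ//; apply: eq_bigr => i _; exact: nZ.
have nZ i A : measurable A -> P (Z i @^-1` A) = normal_prob 0 s A.
  move=> mA.
  have /bZ : forall j, measurable (if j == i then A else setT) by move=> j; case: ifP.
  rewrite (bigD1 i)//= eqxx big1 ?mule1; last first.
    by move=> j /negbTE ->; exact: probability_setT.
  move=> <-; congr (P _); apply/seteqP; split => w /=.
    by move=> Aw j _ /=; case: eqP => // ->.
  by move=> /(_ i Logic.I) /=; rewrite eqxx.
split=> // A mA; rewrite bZ//; apply: eq_bigr => i _; exact/esym/nZ.
Qed.


Lemma bigcap_measurable_fin (I : finType) (F : I -> set T) :
  (forall i, measurable (F i)) -> measurable (\bigcap_(i in [set: I]) F i).
Proof.
move=> mF; apply: fin_bigcap_measurable => //; exact: finite_finset.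
Qed.

Lemma measurable_preimage (Z : T -> R) (A : set R) :
  measurable_fun setT Z -> measurable A -> measurable (Z @^-1` A).
Proof. by move=> mZ mA; rewrite -[X in measurable X]setTI; exact: mZ. Qed.

Lemma iid_normal_inj (I J : finType) (Z : J -> T -> R) (s : R) (j : I -> J) :
  injective j -> iid_normal P Z s -> iid_normal P (fun i => Z (j i)) s.
Proof.
move=> jI /iid_normal_box[mZ bZ]; apply/iid_normal_box; split => // A mA.
(* Side [A i] is placed at index [j i]; indices outside the image are unconstrained and contribute a
   factor 1. *)
pose B k := if [pick i | j i == k] is Some i then A i else setT.
have BE i : B (j i) = A i.
  rewrite /B; case: pickP => [i' /eqP /jI -> //|/(_ i)]; by rewrite eqxx.
have mB k : measurable (B k) by rewrite /B; case: pickP.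
transitivity (P (\bigcap_(k in [set: J]) (Z k @^-1` B k))).
  congr (P _); apply/seteqP; split => w /= Aw.
    move=> k _ /=; rewrite /B; case: pickP => // i /eqP <-; exact: Aw.
  by move=> i _ /=; rewrite -BE; exact: Aw.
rewrite bZ// (bigID [pred k | k \in codom j]) /= [X in (_ * X)%E]big1 ?mule1; last first.
  move=> k kj; rewrite /B; case: pickP => [i /eqP ik|_]; last exact: probability_setT.
  by rewrite -ik codom_f in kj.
rewrite -big_uniq /=; last by rewrite map_inj_uniq ?enum_uniq.
by rewrite big_map big_enum /=; apply: eq_bigr => i _; rewrite BE.
Qed.

(** Fix the sides of the box at all coordinates but [i] and [j]. On that event the pair [(Z i, Z j)]
    is distributed as a constant [r] times the planar normal law, so the planar invariance applies
    to it. *)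
Lemma iid_normal_plane_rot (I : finType) (Z : I -> T -> R) (s c t : R) (i j : I) :
  0 < s -> i != j -> c ^+ 2 + t ^+ 2 = 1 -> t != 0 ->
  iid_normal P Z s -> iid_normal P (plane_rot i j c t Z) s.
Proof.
move=> s0 ij ct t0 /iid_normal_box[mZ bZ]; apply/iid_normal_box; split.
  move=> k; rewrite /plane_rot; case: (k == i); last case: (k == j) => //.
    by apply: measurable_funD; apply: measurable_funM.
  by apply: measurable_funD; apply: measurable_funM.
move=> A mA.
pose U a b k := if k == i then a else if k == j then b else A k.
have ji : (j == i) = false by rewrite eq_sym (negbTE ij).
have mU a b : measurable a -> measurable b -> forall k, measurable (U a b k).
  by move=> ma mb k; rewrite /U; case: ifP => // _; case: ifP.
pose r := (\prod_(k | (k != i) && (k != j)) normal_prob 0 s (A k))%E.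
have prodU a b : (\prod_k normal_prob 0 s (U a b k) =
    normal_prob 0 s a * (normal_prob 0 s b * r))%E.
  rewrite (bigD1 i)//= (bigD1 j)/= 1?eq_sym//; rewrite /U eqxx ji eqxx.
  congr (_ * (_ * _))%E; apply: eq_bigr => k /andP[/negbTE -> /negbTE ->] //.
pose E := \bigcap_(k in [set: I]) (Z k @^-1` U setT setT k).
have mE : measurable E.
  apply: bigcap_measurable_fin => k; apply: measurable_preimage => //; exact: mU.
have PE : P E = r.
  by rewrite /E bZ ?prodU; [rewrite !probability_setT !mul1e|exact: mU].
have rfin : r \is a fin_num by rewrite -PE; exact: fin_num_measure.
have r0 : 0 <= fine r by rewrite fine_ge0// -PE.
pose pair (w : T) : measurableTypeR R * measurableTypeR R := (Z i w, Z j w).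
have mpair : measurable_fun setT pair.
  by apply: measurable_fun_pair; [exact: (mZ i)|exact: (mZ j)].
pose pp : {mfun T >-> (measurableTypeR R * measurableTypeR R)%type} :=
  HB.pack pair (isMeasurableFun.Build _ _ _ _ _ mpair).
(* The unnormalised law of the pair on [E]; it is compared with [m2] on rectangles, which form a
   generating pi-system. *)
pose m1 := pushforward (mrestr P mE) pp.
pose m2 := mscale (NngNum r0) (normal_prob 0 s \x normal_prob 0 s)%E.
have m2E X Y : measurable X -> measurable Y ->
    m2 (X `*` Y) = (r * (normal_prob 0 s X * normal_prob 0 s Y))%E.
  move=> mX mY; rewrite -[in RHS](fineK rfin); congr (_ * _)%E.
  exact: product_measure1E.
have m12 C : measurable C -> m1 C = m2 C.
  apply: (measure_unique [set A `*` B | A in measurable & B in measurable] (fun=> setT)).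
  - by rewrite measurable_prod_measurableType.
  - move=> _ _ [X1 mX1 [X2 mX2 <-]] [Y1 mY1 [Y2 mY2 <-]]; rewrite -setXI.
    by exists (X1 `&` Y1); [exact: measurableI|exists (X2 `&` Y2) => //; exact: measurableI].
  - by move=> _; exists setT => //; exists setT => //; rewrite setXTT.
  - by rewrite bigcup_const.
  - move=> _ [X mX [Y mY <-]].
    apply: etrans (esym (m2E _ _ mX mY)).
    transitivity (P (\bigcap_(k in [set: I]) (Z k @^-1` U X Y k))); last first.
      by rewrite bZ ?prodU; [rewrite muleA muleC|exact: mU].
    rewrite /m1 /pushforward /mrestr; congr (P _); apply/seteqP; split => w /=.
      move=> [[Xw Yw] Ew] k _ /=; rewrite /U; case: eqP => [->//|/eqP ki].
      case: eqP => [->//|/eqP kj]; have := Ew k Logic.I.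
      by rewrite /= /U (negbTE ki) (negbTE kj).
    move=> Uw; split; last first.
      move=> k _ /=; have := Uw k Logic.I; rewrite /= /U.
      by case: eqP => // _; case: eqP.
    split; first by have := Uw i Logic.I; rewrite /= /U eqxx.
    by have := Uw j Logic.I; rewrite /= /U ji eqxx.
  - move=> _; change (P (pp @^-1` setT `&` E) < +oo)%E.
    by rewrite preimage_setT setTI PE ltey_eq rfin.
transitivity (m1 (rot c t @^-1` (A i `*` A j))).
  rewrite /m1 /pushforward /mrestr; congr (P _); apply/seteqP; split => w /=.
    move=> Aw; split; last first.
      move=> k _ /=; rewrite /U; case: eqP => // /eqP ki; case: eqP => // /eqP kj.
      by have := Aw k Logic.I; rewrite /= /plane_rot (negbTE ki) (negbTE kj).
    split; first by have := Aw i Logic.I; rewrite /= /plane_rot eqxx.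
    by have := Aw j Logic.I; rewrite /= /plane_rot ji eqxx.
  move=> [[Ai Aj] Ew] k _ /=; rewrite /plane_rot; case: eqP => [->//|/eqP ki].
  case: eqP => [->//|/eqP kj]; have := Ew k Logic.I.
  by rewrite /= /U (negbTE ki) (negbTE kj).
have mrp : measurable (rot c t @^-1` (A i `*` A j)).
  by rewrite -[X in measurable X]setTI; apply: measurable_rot => //; exact: (measurableX (mA i) (mA j)).
rewrite m12//.
transitivity (r * (normal_prob 0 s (A i) * normal_prob 0 s (A j)))%E.
  rewrite -[in RHS](fineK rfin); congr (_ * _)%E.
  exact: product_normal_rotation.
rewrite (bigD1 i)//= (bigD1 j)/= 1?eq_sym//; rewrite -/r.
by rewrite muleC -muleA.
Qed.

(** Rotations bring a unit row to a basis vector only up to sign; this removes the sign. *)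
Lemma iid_normal_flip (I : finType) (Z : I -> T -> R) (s : R) (i : I) :
  0 < s -> iid_normal P Z s ->
  iid_normal P (fun k w => if k == i then - Z k w else Z k w) s.
Proof.
move=> s0 /iid_normal_box[mZ bZ]; apply/iid_normal_box; split.
  by move=> k; case: (k == i) => //; apply: measurableT_comp.
move=> A mA; pose B k := if k == i then -%R @^-1` A k else A k.
have mB k : measurable (B k).
  rewrite /B; case: ifP => // _; rewrite -[X in measurable X]setTI.
  have : measurable_fun setT (-%R : R -> R) by [].
  exact.
transitivity (P (\bigcap_(k in [set: I]) (Z k @^-1` B k))).
  congr (P _); apply/seteqP; split => w /= Aw k _ /=; have := Aw k Logic.I; rewrite /= /B;
  by case: ifP.
rewrite bZ//; apply: eq_bigr => k _; rewrite /B; case: ifP => // _.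
exact: normal_prob_opp.
Qed.

End iid.

(** * Reduction of orthonormal rows to a selection of coordinates *)

Section orthonormal.
Context {R : realType}.

(** Used twice: with two rows of an array, to keep them orthonormal, and with a row and the random
    vector, to keep the transformed variable unchanged when both are rotated. *)
Lemma plane_rot_dot (I : finType) (S T : Type) (i j : I) (c t : R)
    (U : I -> S -> R) (V : I -> T -> R) x y : i != j -> c ^+ 2 + t ^+ 2 = 1 ->
  \sum_k plane_rot i j c t U k x * plane_rot i j c t V k y =
  \sum_k U k x * V k y.
Proof.
move=> ij ct; have ji : (j == i) = false by rewrite eq_sym (negbTE ij).
rewrite (bigD1 i)//= (bigD1 j)/= 1?eq_sym// [RHS](bigD1 i)//= [in RHS](bigD1 j)/= 1?eq_sym//.
rewrite !addrA; congr (_ + _); last first.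
  by apply: eq_bigr => k /andP[ki kj]; rewrite /plane_rot (negbTE ki) (negbTE kj).
rewrite /plane_rot !eqxx ji.
transitivity ((c ^+ 2 + t ^+ 2) * (U i x * V i y + U j x * V j y)); first by ring.
by rewrite ct mul1r.
Qed.

Let basis_row (J : finType) (v : J -> R) := exists q, forall j, v j = (j == q)%:R.

Let orthonormal (I J : finType) (A : I -> J -> R) :=
  forall i i', \sum_j A i j * A i' j = (i == i')%:R.

Let orthonormal_basis_row (I J : finType) (A : I -> J -> R) i k q :
  orthonormal A -> (forall j, A k j = (j == q)%:R) -> k != i -> A i q = 0.
Proof.
move=> oA Ak ki; have := oA k i.
rewrite (negbTE ki) (bigD1 q)//= Ak eqxx mul1r big1 ?addr0// => j jq.
by rewrite Ak (negbTE jq) mul0r.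
Qed.

Context {d : measure_display} {T : measurableType d} (P : probability T R).

(* Rows are brought one at a time to basis vectors by plane rotations of the
   columns; [D] is the set of rows already treated. *)
Lemma iid_normal_orthonormal (I J : finType) (A : I -> J -> R) (Z : J -> T -> R)
    (s : R) : 0 < s ->
  (forall i i', \sum_j A i j * A i' j = (i == i')%:R) ->
  iid_normal P Z s -> iid_normal P (fun i w => \sum_j A i j * Z j w) s.
Proof.
move=> s0 oA iZ.
(* Outer induction on the number of untreated rows, with the array and the vector generalised
   because each rotation changes both. *)
suff H n : forall (D : {set I}) (A : I -> J -> R), orthonormal A ->
    (forall i, i \in D -> basis_row (A i)) -> (#|~: D| <= n)%N ->
    forall Z, iid_normal P Z s ->
    iid_normal P (fun i w => \sum_j A i j * Z j w) s.
  by apply: (H #|~: (finset.set0 : {set I})| finset.set0) => // i; rewrite inE.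
elim: n => [|n IHn] {A oA Z iZ} D A oA bD cD Z iZ.
  have DT i : i \in D.
    by move: cD; rewrite leqn0 cards_eq0 => /eqP/setP/(_ i); rewrite !inE; case: (i \in D).
  have /choice[q qE] : forall i, exists q, forall j, A i j = (j == q)%:R.
    by move=> i; exact: bD.
  (* All rows are basis vectors; orthogonality makes them distinct, so the transform merely selects
     coordinates. *)
  have qI : injective q.
    move=> i i' qii; apply: contraTeq isT => ii.
    have := orthonormal_basis_row oA (qE i) ii; rewrite qE qii eqxx => /eqP.
    by rewrite oner_eq0.
  rewrite (_ : (fun i w => _) = (fun i => Z (q i))); first exact: iid_normal_inj.
  apply/funext => i; apply/funext => w; rewrite (bigD1 (q i))//= qE eqxx mul1r.
  by rewrite big1 ?addr0// => j jq; rewrite qE (negbTE jq) mul0r.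
have [/eqP|] := boolP (~: D == finset.set0).
  by move=> D0; apply: (IHn D A) => //; rewrite D0 cards0.
case/set0Pn => i; rewrite !inE => iD.
(* Inner induction on the number of nonzero entries of row [i]: each rotation kills one and creates
   none. *)
have [m] := ubnP #|[pred j | A i j != 0]|.
elim: m => // m IHm in A oA bD Z iZ *; rewrite ltnS => sm.
have [j0 j0P] : exists j0, A i j0 != 0.
  apply/existsP; apply: contraTT isT; rewrite negb_exists => /forallP A0.
  have := oA i i; rewrite eqxx big1; first by move/eqP; rewrite eq_sym oner_eq0.
  by move=> j _; have := A0 j; rewrite negbK => /eqP ->; rewrite mul0r.
(* A treated row sits at a column where row [i] vanishes, so rotating two columns where row [i] is
   nonzero leaves treated rows unchanged. *)
have bj0 k q j : k \in D -> (forall j, A k j = (j == q)%:R) -> A i j != 0 -> j != q.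
  move=> kD Ak; apply: contraNneq => ->; apply/eqP; apply: orthonormal_basis_row oA Ak _.
  by apply: contraNneq iD => <-.
have [/existsP[j1 /andP[j10 j1P]]|] := boolP [exists j1, (j1 != j0) && (A i j1 != 0)].
  pose r := Num.sqrt (A i j0 ^+ 2 + A i j1 ^+ 2).
  have r2 : r ^+ 2 = A i j0 ^+ 2 + A i j1 ^+ 2 by rewrite sqr_sqrtr// addr_ge0 ?sqr_ge0.
  have rn0 : r != 0.
    by rewrite -sqrf_eq0 r2 paddr_eq0 ?sqr_ge0// negb_and !sqrf_eq0 j0P.
  (* The angle for which the new entry at [j1], namely [- t * A i j0 + c * A i j1], is zero. *)
  pose c := A i j0 / r; pose t := A i j1 / r.
  have ct : c ^+ 2 + t ^+ 2 = 1.
    by rewrite /c /t !expr_div_n -mulrDl -r2 divff// expf_neq0.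
  have t0 : t != 0 by rewrite mulf_neq0// invr_eq0.
  have j01 : j0 != j1 by rewrite eq_sym.
  pose B k j := plane_rot j0 j1 c t (fun j k => A k j) j k.
  have oB : orthonormal B by move=> k k'; rewrite /B plane_rot_dot.
  rewrite (_ : (fun i w => _) = (fun i w => \sum_j B i j * plane_rot j0 j1 c t Z j w)); last first.
    by apply/funext => k; apply/funext => w; rewrite /B (@plane_rot_dot J I T j0 j1 c t (fun j k => A k j)).
  apply: IHm => //.
  - move=> k kD; have [q qE] := bD k kD; exists q => j.
    have /negbTE q0 := bj0 _ _ _ kD qE j0P; have /negbTE q1 := bj0 _ _ _ kD qE j1P.
    rewrite /B /plane_rot !qE q0 q1 !mulr0 addr0.
    by case: eqP => [->|_]; [rewrite q0|case: eqP => [->|//]; rewrite q1].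
  - exact: iid_normal_plane_rot.
  - apply: leq_trans sm; apply: proper_card; apply/fintype.properP; split.
      apply/fintype.subsetP => j; rewrite !inE /B /plane_rot.
      by case: (j =P j0) => [->//|_]; case: (j =P j1) => [->//|_].
    exists j1; rewrite !inE// negbK /B /plane_rot eqxx (negbTE j10) /c /t.
    by apply/eqP; ring.
rewrite negb_exists => /forallP A0.
have Ai0 j : j != j0 -> A i j = 0.
  by move=> jj; have := A0 j; rewrite jj /= negbK => /eqP.
have := oA i i; rewrite eqxx (bigD1 j0)//= big1 ?addr0; last first.
  by move=> j jj; rewrite Ai0// mul0r.
(* The row has a single nonzero entry, and its unit norm forces that entry to be 1 or -1. *)
move=> /eqP; rewrite -expr2 sqrf_eq1.
have step (B : I -> J -> R) : orthonormal B -> (forall k, k \in D -> basis_row (B k)) ->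
    basis_row (B i) -> forall Z, iid_normal P Z s ->
    iid_normal P (fun i w => \sum_j B i j * Z j w) s.
  move=> oB bB bi Z' iZ'; apply: (IHn (i |: D)) => //.
    by move=> k; rewrite !inE => /orP[/eqP ->//|]; exact: bB.
  rewrite -ltnS (leq_trans _ cD)//; apply: proper_card; apply/fintype.properP; split.
    by apply/fintype.subsetP => k; rewrite !inE negb_or => /andP[].
  by exists i; rewrite !inE ?eqxx.
case/orP => /eqP Ai.
  apply: step => //; exists j0 => j; case: eqP => [->//|/eqP]; exact: Ai0.
pose B k j := if j == j0 then - A k j else A k j.
rewrite (_ : (fun i w => _) = (fun i w => \sum_j B i j *
    (if j == j0 then - Z j w else Z j w))); last first.
  apply/funext => k; apply/funext => w; apply: eq_bigr => j _; rewrite /B.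
  by case: ifP; rewrite ?mulrNN.
apply: step; last exact: iid_normal_flip.
- move=> k k'; rewrite -oA; apply: eq_bigr => j _; rewrite /B.
  by case: ifP; rewrite ?mulrNN.
- move=> k kD; have [q qE] := bD k kD; exists q => j; rewrite /B.
  have q0 := bj0 _ _ _ kD qE j0P.
  by case: eqP => [->|//]; rewrite qE (negbTE q0) oppr0.
- exists j0 => j; rewrite /B; case: eqP => [->|/eqP]; last exact: Ai0.
  by rewrite Ai opprK.
Qed.

End orthonormal.

(** * The law of an iid normal vector *)

Section product_sigma_algebra.
Context {R : realType}.

Definition boxes (I : finType) : set (set (I -> R)) :=
  [set B | exists A : I -> set R, (forall i, measurable (A i)) /\
     B = [set z | forall i, A i (z i)]].

(** Vectors with the product sigma-algebra, generated by the boxes on which [iid_normal_box]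
    prescribes the law. *)
Definition rvec (I : finType) := g_sigma_algebraType (@boxes I).

Lemma measurable_rvec (I : finType) d (T : measurableType d) (Z : T -> rvec I) :
  (forall i, measurable_fun setT (fun w => Z w i)) -> measurable_fun setT Z.
Proof.
move=> mZ; apply: (@measurability _ _ T (rvec I) setT Z (@boxes I)) => //.
move=> _ [_ [A [mA ->]] <-]; rewrite setTI.
rewrite (_ : _ @^-1` _ = \bigcap_(i in [set: I]) ((fun w => Z w i) @^-1` A i)).
  apply: bigcap_measurable_fin => i; exact: measurable_preimage.
by apply/seteqP; split => w /= Aw i => [_|]; apply: Aw.
Qed.

Lemma measurable_rvec_coord (I : finType) (i : I) :
  measurable_fun setT (fun z : rvec I => z i).
Proof.
move=> _ B mB; rewrite setTI; apply: sub_sigma_algebra.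
exists (fun j => if j == i then B else setT); split; first by move=> j; case: ifP.
apply/seteqP; split => z /=; first by move=> Bz j; case: eqP => // ->.
by move=> /(_ i); rewrite eqxx.
Qed.

(** Boxes are closed under intersection and generate the sigma-algebra, and both laws take the same
    value on each of them. *)
Lemma iid_normal_law (I : finType) d (T : measurableType d) (P : probability T R)
    d' (T' : measurableType d') (P' : probability T' R)
    (Z : I -> T -> R) (Z' : I -> T' -> R) (s : R) (C : set (rvec I)) :
  iid_normal P Z s -> iid_normal P' Z' s -> measurable C ->
  P ((fun w => (Z^~ w : rvec I)) @^-1` C) = P' ((fun w => (Z'^~ w : rvec I)) @^-1` C).
Proof.
move=> /iid_normal_box[mZ bZ] /iid_normal_box[mZ' bZ'] mC.
have mV : measurable_fun setT (fun w => (Z^~ w : rvec I)) by exact: measurable_rvec.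
have mV' : measurable_fun setT (fun w => (Z'^~ w : rvec I)) by exact: measurable_rvec.
pose V : {mfun T >-> rvec I} := HB.pack (fun w => (Z^~ w : rvec I)) (isMeasurableFun.Build _ _ _ _ _ mV).
pose V' : {mfun T' >-> rvec I} := HB.pack (fun w => (Z'^~ w : rvec I)) (isMeasurableFun.Build _ _ _ _ _ mV').
change (pushforward P V C = pushforward P' V' C).
apply: (@measure_unique _ R (rvec I) (@boxes I) (fun=> setT)) => //.
- move=> _ _ [A [mA ->]] [B [mB ->]]; exists (fun i => A i `&` B i); split.
    by move=> i; exact: measurableI.
  by apply/seteqP; split => z /= => [[Az Bz] i|ABz]; [|split => i; have [] := ABz i].
- by move=> _; exists (fun=> setT); split => //; apply/seteqP; split.
- by rewrite bigcup_const.
- move=> _ [A [mA ->]]; rewrite /= /pushforward.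
  have := bZ _ mA; rewrite -(bZ' _ mA) => PP.
  transitivity (P (\bigcap_(i in [set: I]) (Z i @^-1` A i))).
    by congr (P _); apply/seteqP; split => w /= Aw i => [_|]; apply: Aw.
  rewrite PP.
  by congr (P' _); apply/seteqP; split => w /= Aw i => [|_]; apply: Aw.
- by move=> _; rewrite /= /pushforward preimage_setT probability_setT ltry.
Qed.

Lemma bounded_integrable d (T : measurableType d) (P : probability T R)
    (h : T -> R) (M : R) : measurable_fun setT h -> (forall z, `|h z| <= M) ->
  P.-integrable setT (fun z => (h z)%:E).
Proof.
move=> mh hM; apply: (@le_integrable _ _ _ _ _ measurableT _ (fun=> M%:E)).
- exact/measurable_EFinP.
- by move=> z _; rewrite /= lee_fin (le_trans (hM z))// ler_norm.
- exact: finite_measure_integrable_cst.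
Qed.

Lemma iid_normal_expectation (I : finType) d (T : measurableType d) (P : probability T R)
    d' (T' : measurableType d') (P' : probability T' R)
    (Z : I -> T -> R) (Z' : I -> T' -> R) (s M : R) (h : rvec I -> R) :
  iid_normal P Z s -> iid_normal P' Z' s ->
  measurable_fun setT h -> (forall z, `|h z| <= M) ->
  (\int[P]_w (h (Z^~ w))%:E = \int[P']_w (h (Z'^~ w))%:E)%E.
Proof.
move=> iZ iZ' mh hM; have [mZ _] := iZ; have [mZ' _] := iZ'.
have mV : measurable_fun setT (fun w => (Z^~ w : rvec I)) by exact: measurable_rvec.
have mV' : measurable_fun setT (fun w => (Z'^~ w : rvec I)) by exact: measurable_rvec.
have mhE : measurable_fun setT (fun z => (h z)%:E) by exact/measurable_EFinP.
have := @integral_pushforward _ _ _ _ _ _ mV P setT _ mhE.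
move=> <-//; last first.
  exact: (@bounded_integrable _ _ P (fun w => h (Z^~ w)) M (measurableT_comp mh mV)).
have := @integral_pushforward _ _ _ _ _ _ mV' P' setT _ mhE.
move=> <-//; last first.
  exact: (@bounded_integrable _ _ P' (fun w => h (Z'^~ w)) M (measurableT_comp mh mV')).
by apply: eq_measure_integral => C mC _; exact: (iid_normal_law iZ iZ').
Qed.

Definition upd (I : eqType) (v : I -> R) (k : I) (x : R) : I -> R :=
  fun i => if i == k then x else v i.

(** One coordinate is replaced by a fresh independent draw; this is the probabilistic content of one
    integration in [gauss_iter]. *)
Lemma iid_normal_resample (I : finType) d (T : measurableType d) (P : probability T R)
    (Z : I -> T -> R) (s : R) (k : I) : iid_normal P Z s ->
  iid_normal (P \x normal_prob 0 s)%E
    (fun i (wx : T * measurableTypeR R) => upd (Z^~ wx.1) k wx.2 i) s.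
Proof.
move=> /iid_normal_box[mZ bZ]; apply/iid_normal_box; split.
  move=> i; rewrite /upd; case: (i == k).
    exact: measurable_snd.
  exact: (measurableT_comp (mZ i) measurable_fst).
move=> A mA; pose B i := if i == k then setT else A i.
have mB i : measurable (B i) by rewrite /B; case: ifP.
rewrite (_ : \bigcap_(i in _) _ =
    (\bigcap_(i in [set: I]) (Z i @^-1` B i)) `*` A k); last first.
  apply/seteqP; split => -[w x] /=.
    move=> H; split; last by have := H k Logic.I; rewrite /= /upd eqxx.
    move=> i _ /=; have := H i Logic.I; rewrite /= /upd /B; by case: ifP.
  move=> [H Ax] i _ /=; have := H i Logic.I; rewrite /= /upd /B.
  by case: eqP => // ->.
apply: etrans (product_measure1E P (normal_prob 0 s) _ (mA k)) _.
  by apply: bigcap_measurable_fin => i; exact: measurable_preimage.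
transitivity ((\prod_i normal_prob 0 s (B i)) * normal_prob 0 s (A k))%E.
  by congr (_ * _)%E; exact: bZ.
rewrite (bigD1 k)//= [RHS](bigD1 k)//= muleC /B eqxx.
rewrite [X in (_ * (X * _))%E]probability_setT mul1e; congr (_ * _)%E.
by apply: eq_bigr => i /negbTE ->.
Qed.

Lemma gauss_iter_indep (I : eqType) (s : R) (l : seq I) h (v v' : I -> R) :
  (forall i, i \notin l -> v i = v' i) -> gauss_iter s l h v = gauss_iter s l h v'.
Proof.
elim: l v v' => [|k l IHl] v v' vv' /=.
  by congr h; apply/funext => i; exact: vv'.
apply: eq_integral => x _; apply: IHl => i il; case: eqP => // /eqP ik.
by apply: vv'; rewrite inE negb_or ik.
Qed.

(** Each integration amounts to resampling one coordinate, which leaves the expectation unchanged.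
    The measurable representative [g] with the same bound [M] is carried along so that Fubini
    applies at the next integration. *)
Lemma iid_normal_gauss_iter (I : finType) d (T : measurableType d) (P : probability T R)
    (Z : I -> T -> R) (s M : R) (h : rvec I -> R) (l : seq I) :
  iid_normal P Z s -> measurable_fun setT h -> (forall z, `|h z| <= M) ->
  exists g : rvec I -> R, [/\ measurable_fun setT g, (forall z, `|g z| <= M),
    (forall v, gauss_iter s l (fun z => (h z)%:E) v = (g v)%:E) &
    (\int[P]_w (g (Z^~ w))%:E = \int[P]_w (h (Z^~ w))%:E)%E].
Proof.
move=> iZ mh hM; elim: l => [|k l [g [mg gM gE gI]]]; first by exists h.
have [mZ _] := iZ.
have mu_ d1 (T1 : measurableType d1) (V : T1 -> rvec I) : measurable_fun setT V ->
    measurable_fun setT (fun vx : T1 * measurableTypeR R => (g (upd (V vx.1) k vx.2))%:E : \bar R).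
  move=> mV; apply/measurable_EFinP; apply: (measurableT_comp mg).
  apply: measurable_rvec => i; rewrite /upd; case: (i == k).
    exact: measurable_snd.
  exact: (measurableT_comp (measurable_rvec_coord i) (measurableT_comp mV measurable_fst)).
have ig (v : rvec I) : (normal_prob 0 s).-integrable setT (fun x => (g (upd v k x))%:E).
  apply: (@bounded_integrable _ _ (normal_prob 0 s) (fun x => g (upd v k x)) M) => //.
  apply: (measurableT_comp mg); apply: measurable_rvec => i.
  by rewrite /upd; case: (i == k).
have fin v : (\int[normal_prob 0 s]_x (g (upd v k x))%:E)%E \is a fin_num.
  exact: integrable_fin_num.
pose g' (v : rvec I) := fine (\int[normal_prob 0 s]_x (g (upd v k x))%:E)%E.
have g'E v : (\int[normal_prob 0 s]_x (g (upd v k x))%:E)%E = (g' v)%:E.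
  by rewrite fineK.
exists g'; split.
- apply/measurable_EFinP.
  rewrite (_ : _ \o _ = fun v => (\int[normal_prob 0 s]_x (g (upd v k x))%:E)%E); last first.
    by apply/funext => v; rewrite g'E.
  (* An arbitrary probability on the first factor: only measurability of the partial integral is
     wanted here. *)
  pose m1 : probability (rvec I) R := \d_(point : rvec I).
  apply: (@measurable_fubini_F _ _ _ _ R m1 (normal_prob 0 s)
    (fun vx : rvec I * measurableTypeR R => (g (upd vx.1 k vx.2))%:E)).
  apply: (@bounded_integrable _ _ _ (fun vx : rvec I * measurableTypeR R => g (upd vx.1 k vx.2)) M) => //.
  by apply/measurable_EFinP; exact: (mu_ _ _ (fun v : rvec I => v)).
- move=> v; rewrite -lee_fin -abse_EFin -g'E.
  apply: le_trans (le_abse_integral _ measurableT (measurable_int _ (ig v))) _.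
  apply: (@le_trans _ _ (\int[normal_prob 0 s]_x M%:E)%E); last first.
    by rewrite integral_cst// [X in (_ * X)%E]probability_setT mule1.
  apply: ge0_le_integral => //.
  + by apply: measurableT_comp => //; exact: measurable_int (ig v).
  + by move=> x _; rewrite abse_EFin lee_fin; exact: gM.
- by move=> v /=; rewrite -g'E; apply: eq_integral => x _; rewrite gE.
rewrite -gI.
have mZv : measurable_fun setT (fun w => (Z^~ w : rvec I)) by exact: measurable_rvec.
rewrite -(iid_normal_expectation (iid_normal_resample k iZ) iZ mg gM).
under eq_integral do rewrite -g'E.
have imu : (P \x normal_prob 0 s)%E.-integrable setT
    (fun wx : T * measurableTypeR R => (g (upd (Z^~ wx.1) k wx.2))%:E).
  apply: (@bounded_integrable _ _ _ (fun wx : T * measurableTypeR R => g (upd (Z^~ wx.1) k wx.2)) M) => //.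
  by apply/measurable_EFinP; exact: (mu_ _ _ (fun w => (Z^~ w : rvec I))).
exact: (integral12_prod_meas1 imu).
Qed.

Lemma iid_normal_gauss_exp (I : finType) d (T : measurableType d) (P : probability T R)
    (Z : I -> T -> R) (s M : R) (h : rvec I -> R) :
  iid_normal P Z s -> measurable_fun setT h -> (forall z, `|h z| <= M) ->
  (\int[P]_w (h (Z^~ w))%:E = gauss_exp s (fun z => (h z)%:E))%E.
Proof.
move=> iZ mh hM.
have [g [mg gM gE <-]] := iid_normal_gauss_iter (enum I) iZ mh hM.
rewrite /gauss_exp gE.
transitivity (\int[P]_w (g (fun=> 0))%:E)%E.
  apply: eq_integral => w _; rewrite -!gE; apply: gauss_iter_indep => i.
  by rewrite mem_enum.
by rewrite integral_cst// [X in (_ * X)%E]probability_setT mule1.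
Qed.

End product_sigma_algebra.

(** * Measurability of functions continuous for the pointwise topology *)

Section continuous_measurable.
Context {R : realType}.

Lemma ptws_cvg (I : Type) (x : nat -> I -> R) (z : I -> R) :
  (forall i, (fun n => x n i) @ \oo --> z i) ->
  (fun n => (x n : {ptws I -> R})) @ \oo --> (z : {ptws I -> R}).
Proof.
move=> xz; apply/cvg_sup => i U.
have /= -> := @nbhsE (initial_topology (fun f : I -> R => f i)) z.
case=> B [[C oC <- Cz]] /filterS; apply.
by apply: (xz i C); rewrite nbhsE; exists C.
Qed.

(** Rounding down to the lattice of mesh [1 / (N + 1)]. For finite [I] it has countably many values,
    each taken on a box, and it tends to the identity coordinatewise. *)
Definition grid (I : Type) (N : nat) (z : I -> R) : I -> R :=
  fun i => (Num.floor (z i * N.+1%:R))%:~R / N.+1%:R.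

Lemma grid_cvg (I : Type) (z : I -> R) i : (fun N => grid N z i) @ \oo --> z i.
Proof.
apply/cvgrPdist_lt => e e0; near=> N.
have N0 : 0 < N.+1%:R :> R by [].
rewrite /grid; set x := z i.
have /andP[h1 h2] := Num.Theory.floor_itv (x * N.+1%:R).
have -> : x - (Num.floor (x * N.+1%:R))%:~R / N.+1%:R =
  (x * N.+1%:R - (Num.floor (x * N.+1%:R))%:~R) / N.+1%:R.
  by rewrite mulrBl mulfK.
rewrite normrM normfV (gtr0_norm N0) ger0_norm ?subr_ge0//.
apply: (@le_lt_trans _ _ (N.+1%:R^-1)).
  rewrite ler_piMl ?invr_ge0//.
  by move: h2; rewrite intrD; lra.
by near: N; exact: (near_infty_natSinv_lt (PosNum e0)).
Unshelve. all: by end_near. Qed.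

Lemma measurable_grid_comp (I : finType) (N : nat) (f : (I -> R) -> R) :
  measurable_fun setT (fun z : rvec I => f (grid N z)).
Proof.
move=> _ B mB; rewrite setTI.
pose Q (q : {ffun I -> int}) : set (rvec I) :=
  [set z | (forall i, Num.floor (z i * N.+1%:R) = q i) /\ B (f (grid N z))].
rewrite (_ : _ @^-1` _ = \bigcup_q Q q); last first.
  apply/seteqP; split => z /=.
    move=> Bz; exists [ffun i => Num.floor (z i * N.+1%:R)] => //.
    by split => // i; rewrite ffunE.
  by move=> [q _ []].
apply: countable_bigcupT_measurable => // q.
have [Bq|Bq] := pselect (B (f (fun i => (q i)%:~R / N.+1%:R))).
  rewrite (_ : Q q = [set z | forall i, `[(q i)%:~R / N.+1%:R, (q i + 1)%:~R / N.+1%:R[%classic (z i)]).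
    by apply: sub_sigma_algebra; exists (fun i => `[(q i)%:~R / N.+1%:R, (q i + 1)%:~R / N.+1%:R[%classic).
  apply/seteqP; split => z.
    move=> [qz _] i /=; rewrite in_itv /= ler_pdivrMr// ltr_pdivlMr//.
    by rewrite -Num.Theory.floor_eq qz.
  move=> qz; have fq i : Num.floor (z i * N.+1%:R) = q i.
    apply/eqP; rewrite Num.Theory.floor_eq; have := qz i.
    by rewrite /= in_itv /= ler_pdivrMr// ltr_pdivlMr//.
  split => //; rewrite (_ : grid N z = (fun i => (q i)%:~R / N.+1%:R))//.
  by apply/funext => i; rewrite /grid fq.
rewrite (_ : Q q = set0)//; apply/seteqP; split => // z [fq Bz]; apply: Bq.
rewrite (_ : (fun i => (q i)%:~R / N.+1%:R) = grid N z)//.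
by apply/funext => i; rewrite /grid fq.
Qed.

(** Pointwise limit of the functions [f \o grid N], which are measurable for boxes; no comparison of
    open sets with boxes is needed. *)
Lemma ptws_continuous_measurable (I : finType) (f : {ptws I -> R} -> R) :
  continuous f -> measurable_fun setT (f : rvec I -> R).
Proof.
move=> cf; apply: (@measurable_fun_cvg _ (rvec I) R setT (fun N (z : rvec I) => f (grid N z))).
  by move=> N; exact: measurable_grid_comp.
move=> z _; apply: (cvg_comp (fun N => (grid N z : {ptws I -> R})) f).
  by apply: ptws_cvg => i; exact: grid_cvg.
exact: cf.
Qed.

End continuous_measurable.

(** * Medians of a normal law mixed with a point mass at zero *)

Section normal_cdf.
Context {R : realType}.

Definition std_cdf (x : R) : R := fine (normal_prob 0 1 `]-oo, x]%classic).

Lemma std_cdfE x : normal_prob 0 1 `]-oo, x]%classic = (std_cdf x)%:E.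
Proof. by rewrite fineK// fin_num_measure. Qed.

Lemma std_cdf_ge0 x : 0 <= std_cdf x. Proof. by rewrite fine_ge0. Qed.

Lemma le_std_cdf x y : x <= y -> std_cdf x <= std_cdf y.
Proof.
move=> xy; rewrite -lee_fin -!std_cdfE le_measure ?inE//.
by apply: subset_itvl; rewrite bnd_simp.
Qed.

Lemma normal_prob_set1 (x : R) : normal_prob 0 1 [set x] = 0%E.
Proof.
have /null_content_dominatesP dom := @normal_prob_dominates R 0 1.
by apply: dom => //; exact: lebesgue_measure_set1.
Qed.

Lemma std_cdf_opp (x : R) : std_cdf (- x) = 1 - std_cdf x.
Proof.
have E1 : normal_prob 0 1 `]-oo, - x]%classic = normal_prob 0 1 `[x, +oo[%classic.
  rewrite -(@normal_prob_opp R 1 `]-oo, - x]%classic)//; congr normal_prob.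
  by apply/seteqP; split => y /=; rewrite !in_itv /= andbT lerN2.
have E2 : normal_prob 0 1 `[x, +oo[%classic = normal_prob 0 1 `]x, +oo[%classic.
  have -> : `[x, +oo[%classic = [set x] `|` `]x, +oo[%classic.
    apply/seteqP; split => y /=; rewrite !in_itv /= !andbT le_eqVlt.
      by move=> /orP[/eqP ->|]; [left|right].
    by move=> [->|->]; rewrite ?eqxx ?orbT.
  rewrite measureU//; first by rewrite [X in (X + _)%E]normal_prob_set1 add0e.
  by apply/seteqP; split => // y [/= ->]; rewrite in_itv /= ltxx.
have : (normal_prob 0 1 `]-oo, x]%classic + normal_prob 0 1 `]x, +oo[%classic = 1 :> \bar R)%E.
  rewrite -measureU//; last first.
    by apply/seteqP; split => // y [/=]; rewrite !in_itv /= andbT leNgt => /negP.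
  rewrite -(probability_setT (normal_prob (0 : R) 1)); congr normal_prob.
  by apply/seteqP; split => // y _ /=; rewrite !in_itv /= andbT; case: (leP y x); [left|right].
rewrite -E2 -E1 !std_cdfE -EFinD => -[]; lra.
Qed.

Lemma std_cdf0 : std_cdf 0 = 2^-1.
Proof. by have := std_cdf_opp 0; rewrite oppr0; lra. Qed.

(** The density decreases on the positive half-line, so []0, x]] has mass at least
    [x * normal_pdf 0 1 x], which is positive. *)
Lemma std_cdf_gt_half (x : R) : 0 < x -> 2^-1 < std_cdf x.
Proof.
move=> x0; rewrite -std_cdf0 -lte_fin -!std_cdfE.
have -> : `]-oo, x]%classic = `]-oo, 0]%classic `|` `]0, x]%classic :> set R.
  by rewrite -itv_bndbnd_setU// bnd_simp ltW.
rewrite measureU//; last first.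
  by apply/seteqP; split => // y [/=]; rewrite !in_itv /= => y0 /andP[]; rewrite ltNge y0.
rewrite lteDl ?fin_num_measure//.
pose J : set R := `]0, x]%classic.
have H1 : (0 < \int[lebesgue_measure]_(y in J) (normal_pdf 0 1 x)%:E)%E.
  rewrite integral_cst /J//= lebesgue_measure_itv /= lte_fin x0 oppr0 adde0 -EFinM lte_fin.
  rewrite mulr_gt0// normal_pdfE ?oner_eq0// mulr_gt0 ?expR_gt0//.
  by rewrite /normal_peak invr_gt0 sqrtr_gt0 mulrn_wgt0// mulr_gt0 ?pi_gt0 ?exprn_gt0.
suff H2 : (\int[lebesgue_measure]_(y in J) (normal_pdf 0 1 x)%:E <= normal_prob 0 1 J)%E by exact: lt_le_trans H1 H2.
rewrite /normal_prob; apply: ge0_le_integral => //.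
- exact: measurable_itv.
- by move=> y _; rewrite lee_fin normal_pdf_ge0.
- by apply/measurable_EFinP; apply: measurable_funTS; exact: measurable_normal_pdf.
move=> y; rewrite /J /= in_itv /= => /andP[y0 yx]; rewrite lee_fin.
rewrite !normal_pdfE ?oner_eq0//; apply: ler_wpM2l; first exact: normal_peak_ge0.
rewrite /normal_fun !subr0 expr1n ler_expR !mulNr lerN2.
rewrite ler_pM2r ?invr_gt0//.
by rewrite ler_sqr// nnegrE ltW// (lt_le_trans y0).
Qed.

Lemma std_cdf_lt_half (x : R) : 0 < x -> std_cdf (- x) < 2^-1.
Proof. by move=> /std_cdf_gt_half; rewrite std_cdf_opp; lra. Qed.

Lemma measurable_std_cdf : measurable_fun setT std_cdf.
Proof. by apply: nondecreasing_measurable => // x y; exact: le_std_cdf. Qed.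

Definition mix_cdf (p mean s t : R) : R :=
  (1 - p) * std_cdf ((t - mean) / s) + p * ((0 <= t)%R)%:R.

Definition mix_med (p mean s : R) : R := inf [set t | 2^-1 <= mix_cdf p mean s t].

Lemma le_mix_cdf (p mean s t t' : R) : 0 <= p -> p <= 1 -> 0 < s -> t <= t' ->
  mix_cdf p mean s t <= mix_cdf p mean s t'.
Proof.
move=> p0 p1 s0 tt; apply: lerD.
  apply: ler_wpM2l; first by rewrite subr_ge0.
  by apply: le_std_cdf; rewrite ler_pM2r ?invr_gt0// lerD2r.
apply: ler_wpM2l => //; case: (leP 0 t) => t0; last by rewrite ler0n.
by rewrite (le_trans t0 tt).
Qed.

(** [inf] has its meaning only on a nonempty set bounded below; every use of [mix_med] starts from
    this. *)
Lemma mix_med_has_inf (p mean s : R) : 0 <= p -> p <= 1 -> 0 < s ->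
  has_inf [set t | 2^-1 <= mix_cdf p mean s t].
Proof.
move=> p0 p1 s0; split.
  (* Here both components of the mixture have reached one half. *)
  exists (Num.max 0 mean) => /=; rewrite /mix_cdf le_max lexx mulr1.
  have : 2^-1 <= std_cdf ((Num.max 0 mean - mean) / s).
    by rewrite -std_cdf0; apply: le_std_cdf; apply: divr_ge0; rewrite ?(ltW s0)// subr_ge0 le_max lexx orbT.
  move: (std_cdf _) => c hc; nra.
(* Below this bound the point mass contributes nothing and the normal part is strictly under one
   half. *)
exists (Num.min (-1) (mean - s)) => t /= ht; rewrite leNgt; apply/negP => tm.
have t0 : t < 0 by move: tm; rewrite lt_min => /andP[]; lra.
have tms : t < mean - s by move: tm; rewrite lt_min => /andP[].
move: ht; apply/negP; rewrite -ltNge /mix_cdf leNgt t0 mulr0 addr0.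
have : std_cdf ((t - mean) / s) < 2^-1.
  apply: le_lt_trans (std_cdf_lt_half ltr01); apply: le_std_cdf.
  by rewrite ler_pdivrMr// mulN1r; lra.
have := std_cdf_ge0 ((t - mean) / s); move: (std_cdf _) => c c0 hc; nra.
Qed.

(** The jump at 0 alone crosses one half: the distribution function is at most [1 - p] before 0 and
    at least [p] at 0. This is the source of exact zeros. *)
Lemma mix_med_eq0 (p mean s : R) : 2^-1 < p -> p <= 1 -> 0 < s -> mix_med p mean s = 0.
Proof.
move=> ph p1 s0; have p0 : 0 <= p by lra.
have [ne lb] := mix_med_has_inf mean p0 p1 s0.
apply/eqP; rewrite eq_le; apply/andP; split.
  apply: ge_inf => //=; rewrite /mix_cdf lexx mulr1.
  by have := std_cdf_ge0 ((0 - mean) / s); move: (std_cdf _) => c c0; nra.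
apply: lb_le_inf => // t /=; rewrite leNgt => ht; rewrite leNgt; apply/negP => t0.
move/negP: ht; apply; rewrite /mix_cdf leNgt t0 mulr0 addr0.
have : std_cdf ((t - mean) / s) <= 1.
  rewrite -lee_fin -std_cdfE -(probability_setT (normal_prob (0:R) 1)).
  by rewrite le_measure ?inE.
have := std_cdf_ge0 ((t - mean) / s); move: (std_cdf _) => c c0 c1; nra.
Qed.

(** The two assumptions take the worst position of the atom: above [mean] it is given no credit,
    below [mean] it is counted in full. The bound therefore holds whatever the sign of [mean]. *)
Lemma mix_med_close (p mean s e : R) : 0 <= p -> p <= 1 -> 0 < s -> 0 < e ->
  2^-1 <= (1 - p) * std_cdf e -> (1 - p) * std_cdf (- e) + p < 2^-1 ->
  `|mix_med p mean s - mean| <= e * s.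
Proof.
move=> p0 p1 s0 e0 h1 h2.
have [ne lb] := mix_med_has_inf mean p0 p1 s0.
rewrite ler_distl; apply/andP; split.
  apply: lb_le_inf => // t /= ht; rewrite leNgt; apply/negP => tm.
  move: ht; apply/negP; rewrite -ltNge; apply: le_lt_trans h2; apply: lerD.
    apply: ler_wpM2l; first by rewrite subr_ge0.
    by apply: le_std_cdf; rewrite ler_pdivrMr//; lra.
  by apply: ler_piMr => //; case: (0 <= t).
apply: ge_inf => //=; rewrite /mix_cdf addrAC subrr add0r mulfK ?gt_eqF//.
by apply: (le_trans h1); rewrite lerDl mulr_ge0.
Qed.

(** By monotonicity the median is below [r] exactly when the distribution function reaches one half
    at some rational below [r], a countable union of measurable conditions. *)
Lemma measurable_mix_med d (T : measurableType d) (p mean : T -> R) s :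
  measurable_fun setT p -> measurable_fun setT mean ->
  (forall z, 0 <= p z) -> (forall z, p z <= 1) -> 0 < s ->
  measurable_fun setT (fun z => mix_med (p z) (mean z) s).
Proof.
move=> mp mm p0 p1 s0.
apply: (measurability (@RGenInftyO.G R)) => [|_ [_ [r ->] <-]].
  exact: RGenInftyO.measurableE.
rewrite setTI.
pose F (q : rat) := [set z | ratr q < r /\ 2^-1 <= mix_cdf (p z) (mean z) s (ratr q)].
rewrite (_ : _ @^-1` _ = \bigcup_q F q).
  apply: bigcupT_measurable_rat => q; have [qr|qr] := pselect (ratr q < r :> R); last first.
    by rewrite (_ : F q = set0)//; apply/seteqP; split => // z [].
  rewrite (_ : F q = (fun z => mix_cdf (p z) (mean z) s (ratr q)) @^-1` `[2^-1, +oo[%classic).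
    rewrite -[X in measurable X]setTI.
    have : measurable_fun setT (fun z => mix_cdf (p z) (mean z) s (ratr q)).
      apply: measurable_funD; last by apply: measurable_funM.
      apply: measurable_funM; first exact: measurable_funB.
      apply: measurableT_comp; first exact: measurable_std_cdf.
      by apply: measurable_funM => //; apply: measurable_funB.
    by apply.
  by apply/seteqP; split => z /=; rewrite in_itv /= andbT; [case|].
apply/seteqP; split => z /=.
  rewrite in_itv /= => mr.
  have [ne lb] := mix_med_has_inf (mean z) (p0 z) (p1 z) s0.
  have [t /= ht tr] := inf_lt ne mr.
  have [q] := rat_in_itvoo tr; rewrite in_itv /= => /andP[tq qr].
  exists q => //; split => //; apply: (le_trans ht); apply: le_mix_cdf => //.
  exact: ltW.
move=> [q _ [qr hq]]; rewrite in_itv /=; apply: le_lt_trans qr.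
by apply: ge_inf => //; have [] := mix_med_has_inf (mean z) (p0 z) (p1 z) s0.
Qed.

End normal_cdf.

(** * The posterior *)

Section gaussian_products.
Context {R : realType}.

Lemma gauss_iter_prod (I : finType) (s C : R) (l : seq I) (h : I -> R -> R)
    (c : I -> R) (v : I -> R) : uniq l -> 0 <= C ->
  (forall k, measurable_fun setT (h k)) -> (forall k x, 0 <= h k x) ->
  (forall k, \int[normal_prob 0 s]_x (h k x)%:E = (c k)%:E)%E ->
  gauss_iter s l (fun v => (C * \prod_k h k (v k))%:E) v =
  (C * \prod_k (if k \in l then c k else h k (v k)))%:E.
Proof.
move=> ul C0 mh h0 hc; elim: l v ul => [|a l IHl] v /=; first by [].
move=> /andP[al ul].
pose r := C * \prod_(k | k != a) (if k \in l then c k else h k (v k)).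
have c0 k : 0 <= c k by rewrite -lee_fin -hc; apply: integral_ge0 => x _; rewrite lee_fin.
have r0 : 0 <= r by rewrite mulr_ge0// prodr_ge0// => k _; case: ifP.
transitivity (\int[normal_prob 0 s]_x ((h a x)%:E * r%:E))%E.
  apply: eq_integral => x _; rewrite IHl// -EFinM; congr EFin.
  rewrite (bigD1 a)//= (negbTE al) eqxx /r mulrCA; congr (_ * (_ * _)).
  by apply: eq_bigr => k /negbTE ->.
rewrite ge0_integralZr//; last 2 first.
- by apply/measurable_EFinP; exact: mh.
- by move=> x _; rewrite lee_fin; exact: h0.
rewrite hc -EFinM; congr EFin; rewrite [in RHS](bigD1 a)//= inE eqxx /= /r mulrCA.
congr (_ * (_ * _)); apply: eq_bigr => k ka; by rewrite inE (negbTE ka).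
Qed.

Lemma gauss_exp_prod (I : finType) (s C : R) (h : I -> R -> R) (c : I -> R) : 0 <= C ->
  (forall k, measurable_fun setT (h k)) -> (forall k x, 0 <= h k x) ->
  (forall k, \int[normal_prob 0 s]_x (h k x)%:E = (c k)%:E)%E ->
  gauss_exp s (fun v => (C * \prod_k h k (v k))%:E) = (C * \prod_k c k)%:E.
Proof.
move=> C0 mh h0 hc; rewrite /gauss_exp (gauss_iter_prod _ _ _ mh h0 hc) ?enum_uniq//.
by congr (_ * _)%:E; apply: eq_bigr => k _; rewrite mem_enum.
Qed.

(** Expanding the product over groups by distributivity yields one term for each set [S] of slab
    groups, which is the mixture in [prior_exp]. *)
Lemma prior_exp_prod (G : nat) (m : 'I_G -> nat) (sigma pi0 C : R) (tau2 : 'I_G -> R)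
    (f : gcoord G m -> R -> R) (c : gcoord G m -> R) : 0 <= C ->
  (forall k, measurable_fun setT (f k)) -> (forall k x, 0 <= f k x) ->
  (forall k, \int[normal_prob 0 1]_x
     (f k (sigma * Num.sqrt (tau2 (tag k)) * x)%R)%:E = (c k)%:E)%E ->
  prior_exp sigma pi0 tau2 (fun b => (C * \prod_k f k (b k))%:E) =
  (C * \prod_(g < G) ((1 - pi0) * \prod_(k : gcoord G m | tag k == g) c k +
                      pi0 * \prod_(k : gcoord G m | tag k == g) f k 0))%:E.
Proof.
move=> C0 mf f0 fc; rewrite bigA_distr big_distrr -sumEFin /prior_exp.
apply: eq_big => [S|S _]; first by rewrite inE.
pose h (k : gcoord G m) x := if tag k \in S
  then f k (sigma * Num.sqrt (tau2 (tag k)) * x) else f k 0.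
have -> : (fun z : gcoord G m -> R => (C * \prod_k f k (if tag k \in S
    then sigma * Num.sqrt (tau2 (tag k)) * z k else 0))%:E) =
    (fun z => (C * \prod_k h k (z k))%:E).
  by apply/funext => z; congr (_ * _)%:E; apply: eq_bigr => k _; rewrite /h; case: ifP.
rewrite (@gauss_exp_prod _ _ _ _ (fun k => if tag k \in S then c k else f k 0))//; last 3 first.
- move=> k; rewrite /h; case: (tag k \in S) => //.
  apply: (measurableT_comp (mf k)); exact: measurable_funM.
- by move=> k x; rewrite /h; case: ifP => _; exact: f0.
- move=> k; rewrite /h; case: (tag k \in S); first exact: fc.
  by rewrite integral_cst// [X in (_ * X)%E]probability_setT mule1.
rewrite -EFinM; congr EFin; rewrite mulrCA; congr (_ * _).
have -> : (1 - pi0) ^+ #|S| * pi0 ^+ (G - #|S|) =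
    \prod_(g < G) (if g \in S then 1 - pi0 else pi0).
  have GS : (G - #|S|)%N = #|~: S|.
    have cG : (#|S| + #|~: S|)%N = G by rewrite cardsC card_ord.
    by rewrite -[X in (X - _)%N]cG addKn.
  rewrite GS -!prodr_const [RHS](bigID [in S]) /=; congr (_ * _).
    by apply: eq_bigr => g ->.
  by apply: eq_big => g; rewrite ?inE// => /negbTE ->.
rewrite (partition_big (@tag _ _) predT)//= -big_split /=; apply: eq_bigr => g _.
case: ifP => gS; congr (_ * _); apply: eq_bigr => k /eqP ->; by rewrite gS.
Qed.

(** The Bayes factor of slab against spike in one coordinate: the slab integral of [tilt], which
    equals 1 at the spike. *)
Definition slab_evidence (sigma tau2 u : R) (n : nat) : R :=
  (Num.sqrt (1 + n%:R * tau2))^-1 *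
  expR (tau2 * u ^+ 2 / (sigma ^+ 2 * (1 + n%:R * tau2) *+ 2)).

(* Factor of the likelihood in one coordinate [b], with [u] the matching
   coordinate of X^T Y; the factor free of [b] is dropped. *)
Definition tilt (sigma u : R) (n : nat) (b : R) : R :=
  expR ((b * u *+ 2 - n%:R * b ^+ 2) / (sigma ^+ 2 *+ 2)).

Lemma measurable_tilt sigma u n : measurable_fun setT (tilt sigma u n).
Proof.
apply: measurableT_comp => //; apply: measurable_funM => //; apply: measurable_funB.
  rewrite (_ : (fun b : R => _) = fun b => u *+ 2 * b); first exact: measurable_funM.
  by apply/funext => b; ring.
by apply: measurable_funM => //; exact: measurable_funX.
Qed.

(* Completing the square: the prior times the likelihood factor of one
   coordinate is a multiple of a normal density. *)
Lemma integral_tilt (sigma tau2 u : R) (n : nat) (A : set R) :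
  0 < sigma -> 0 < tau2 -> measurable A ->
  (\int[normal_prob 0 1]_x (\1_A x * tilt sigma u n (sigma * Num.sqrt tau2 * x)%R)%:E =
   (slab_evidence sigma tau2 u n)%:E *
   normal_prob (Num.sqrt tau2 * u / (sigma * (1 + n%:R * tau2))%R)
     (Num.sqrt (1 + n%:R * tau2))^-1 A)%E.
Proof.
move=> s0 t0 mA.
set D := 1 + n%:R * tau2; have D0 : 0 < D by rewrite ltr_pwDl// mulr_ge0// ltW.
set q := Num.sqrt D; have q0 : 0 < q by rewrite sqrtr_gt0.
have q2 : q ^+ 2 = D by rewrite sqr_sqrtr// ltW.
set r := Num.sqrt tau2; have r0 : 0 < r by rewrite sqrtr_gt0.
have r2 : r ^+ 2 = tau2 by rewrite sqr_sqrtr// ltW.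
have e0 : 0 <= slab_evidence sigma tau2 u n by rewrite mulr_ge0 ?expR_ge0// invr_ge0.
have mI : measurable_fun setT (fun x => \1_A x * tilt sigma u n (sigma * r * x)).
  apply: measurable_funM => //; apply: (measurableT_comp (measurable_tilt sigma u n)).
  exact: measurable_funM.
rewrite ge0_integral_normal_prob; last 2 first.
- exact/measurable_EFinP.
- by move=> x; rewrite lee_fin mulr_ge0 ?expR_ge0// indicE.
rewrite normal_prob_integral// -ge0_integralZl//; last 2 first.
- exact: measurable_indic_normal_pdf.
- by move=> x _; exact: indic_normal_pdf_ge0.
apply: eq_integral => x _; rewrite -!EFinM; congr EFin.
rewrite -(mulrA (\1_A x)) [RHS]mulrCA; congr (_ * _).
have qi0 : q^-1 != 0 by rewrite invr_eq0 gt_eqF.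
rewrite !normal_pdfE ?oner_eq0// /normal_fun.
have -> : normal_peak q^-1 = q * normal_peak 1 :> R.
  rewrite /normal_peak -!mulrnAr sqrtrM ?sqr_ge0// sqrtr_sqr gtr0_norm ?invr_gt0//.
  rewrite expr1n mul1r invfM invrK//.
rewrite mulrCA [RHS]mulrCA /slab_evidence -/D -/q.
transitivity (normal_peak 1 * (expR (tau2 * u ^+ 2 / (sigma ^+ 2 * D *+ 2)) *
  expR (- (x - r * u / (sigma * D)) ^+ 2 / (q^-1 ^+ 2 *+ 2)))); last first.
  by have := lt0r_neq0 q0 => qn0; field.
congr (_ * _); rewrite /tilt -!expRD; congr expR.
rewrite exprVn q2 -r2 subr0 expr1n.
have -> : D = 1 + n%:R * r ^+ 2 by rewrite r2.
have Dn : 1 + n%:R * r ^+ 2 != 0 by rewrite r2 gt_eqF.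
by field; rewrite Dn (lt0r_neq0 s0).
Qed.

Lemma lik_prod (G : nat) (m : 'I_G -> nat) (n : nat) (X : 'I_n -> gcoord G m -> R)
    (sigma : R) (y : 'I_n -> R) (b : gcoord G m -> R) :
  (forall k l, \sum_(i < n) X i k * X i l = (k == l)%:R * n%:R) ->
  lik X sigma y b = expR (- (\sum_(i < n) y i ^+ 2) / (sigma ^+ 2 *+ 2)) *
    \prod_k tilt sigma (\sum_(i < n) X i k * y i) n (b k).
Proof.
move=> XX; rewrite /lik /tilt -expR_sum -expRD; congr expR.
rewrite -mulr_suml -mulrDl; congr (_ / _).
have E1 : \sum_(i < n) y i * (\sum_k X i k * b k) = \sum_k b k * \sum_(i < n) X i k * y i.
  under eq_bigr do rewrite mulr_sumr.
  rewrite exchange_big; apply: eq_bigr => k _; rewrite mulr_sumr; apply: eq_bigr => i _; ring.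
have E2 : \sum_(i < n) (\sum_k X i k * b k) ^+ 2 = \sum_k n%:R * b k ^+ 2.
  transitivity (\sum_(i < n) \sum_k \sum_l b k * b l * (X i k * X i l)).
    apply: eq_bigr => i _; rewrite expr2 mulr_suml; apply: eq_bigr => k _.
    rewrite mulr_sumr; apply: eq_bigr => l _; ring.
  rewrite exchange_big; apply: eq_bigr => k _ /=; rewrite exchange_big /=.
  under eq_bigr do rewrite -mulr_sumr XX.
  rewrite (bigD1 k)//= eqxx /= mul1r big1 ?addr0; first by ring.
  by move=> l; rewrite eq_sym => /negbTE ->; rewrite mul0r mulr0.
have -> : \sum_(i < n) (y i - \sum_k X i k * b k) ^+ 2 = \sum_(i < n) y i ^+ 2 -
    (\sum_(i < n) y i * (\sum_k X i k * b k)) *+ 2 +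
    \sum_(i < n) (\sum_k X i k * b k) ^+ 2.
  by rewrite -sumrMnl -sumrB -big_split; apply: eq_bigr => i _; rewrite /=; ring.
rewrite E1 E2 sumrB sumrMnl; ring.
Qed.

End gaussian_products.

(** * The posterior median as a function of the score *)

Section posterior_median.
Context {R : realType} (G : nat) (m : 'I_G -> nat).
Local Notation I := (gcoord G m).

Definition slab_ratio (sigma : R) (tau2 : 'I_G -> R) (n : nat) (u : I -> R) (g : 'I_G) : R :=
  \prod_(k : I | tag k == g) slab_evidence sigma (tau2 (tag k)) (u k) n.

(** The posterior probability of the spike for group [g], by Bayes' rule with likelihood ratio
    [slab_ratio]. *)
Definition null_weight (sigma pi0 : R) (tau2 : 'I_G -> R) (n : nat) (u : I -> R) (g : 'I_G) : R :=
  pi0 / ((1 - pi0) * slab_ratio sigma tau2 n u g + pi0).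

Definition slab_mean (tau2 u : R) (n : nat) : R := tau2 * u / (1 + n%:R * tau2).

Definition slab_sd (sigma tau2 : R) (n : nat) : R :=
  sigma * Num.sqrt tau2 / Num.sqrt (1 + n%:R * tau2).

Definition median_of_score (sigma pi0 : R) (tau2 : 'I_G -> R) (n : nat) (u : I -> R) (k : I) : R :=
  mix_med (null_weight sigma pi0 tau2 n u (tag k))
    (slab_mean (tau2 (tag k)) (u k) n) (slab_sd sigma (tau2 (tag k)) n).

Lemma slab_evidence_gt0 (sigma tau2 u : R) n : 0 < tau2 -> 0 < slab_evidence sigma tau2 u n.
Proof.
move=> t0; rewrite mulr_gt0 ?expR_gt0// invr_gt0 sqrtr_gt0.
by rewrite ltr_pwDl// mulr_ge0// ltW.
Qed.

Lemma slab_ratio_gt0 sigma tau2 n u g : (forall g, 0 < tau2 g) ->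
  0 < slab_ratio sigma tau2 n u g.
Proof. by move=> t0; apply: prodr_gt0 => k _; exact: slab_evidence_gt0. Qed.

Lemma null_weight_itv sigma pi0 tau2 n u g : 0 < pi0 < 1 -> (forall g, 0 < tau2 g) ->
  0 <= null_weight sigma pi0 tau2 n u g <= 1.
Proof.
move=> /andP[p0 p1] t0; have := slab_ratio_gt0 sigma n u g t0.
rewrite /null_weight; set L := slab_ratio _ _ _ _ _ => L0.
have h : 0 < (1 - pi0) * L by rewrite mulr_gt0// subr_gt0.
by apply/andP; split; [rewrite divr_ge0//; lra|rewrite ler_pdivrMr; lra].
Qed.

Lemma slab_sd_gt0 (sigma tau2 : R) n : 0 < sigma -> 0 < tau2 -> 0 < slab_sd sigma tau2 n.
Proof.
move=> s0 t0; rewrite divr_gt0// ?mulr_gt0 ?sqrtr_gt0//.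
by rewrite ltr_pwDl// mulr_ge0// ltW.
Qed.

Lemma tilt0 (sigma u : R) n : tilt sigma u n 0 = 1.
Proof. by rewrite /tilt mul0r mul0rn expr0n mulr0 subr0 mul0r expR0. Qed.

Lemma integral_tilt_le (sigma tau2 u t : R) (n : nat) : 0 < sigma -> 0 < tau2 ->
  (\int[normal_prob 0 1]_x (((sigma * Num.sqrt tau2 * x <= t)%R)%:R *
      tilt sigma u n (sigma * Num.sqrt tau2 * x)%R)%:E =
  (slab_evidence sigma tau2 u n *
    std_cdf ((t - slab_mean tau2 u n) / slab_sd sigma tau2 n))%:E)%E.
Proof.
move=> s0 t0; pose A : set R := [set x | sigma * Num.sqrt tau2 * x <= t].
have D0 : 0 < 1 + n%:R * tau2 by rewrite ltr_pwDl// mulr_ge0// ltW.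
have r0 : 0 < Num.sqrt tau2 by rewrite sqrtr_gt0.
have sr0 : 0 < sigma * Num.sqrt tau2 by rewrite mulr_gt0.
have q0 : 0 < Num.sqrt (1 + n%:R * tau2) by rewrite sqrtr_gt0.
have AE : A = `]-oo, t / (sigma * Num.sqrt tau2)]%classic.
  by apply/seteqP; split => x; rewrite /A /= in_itv /= ler_pdivlMr// mulrC.
have mA : measurable A by rewrite AE; exact: measurable_itv.
transitivity (\int[normal_prob 0 1]_x (\1_A x * tilt sigma u n (sigma * Num.sqrt tau2 * x)%R)%:E)%E.
  apply: eq_integral => x _; rewrite indicE; congr (_%:R * _)%:E; congr nat_of_bool.
  by apply/idP/idP; rewrite inE.
rewrite EFinM; apply: etrans (integral_tilt u n s0 t0 mA) _; congr (_ * _)%E.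
apply: etrans (normal_prob_standard _ _ mA) _; first by rewrite invr_gt0.
rewrite -std_cdfE; congr (normal_prob 0 1 _).
have sd0 := slab_sd_gt0 n s0 t0.
have key x : sigma * Num.sqrt tau2 * (Num.sqrt tau2 * u / (sigma * (1 + n%:R * tau2)) +
    (Num.sqrt (1 + n%:R * tau2))^-1 * x) = slab_mean tau2 u n + x * slab_sd sigma tau2 n.
  rewrite /slab_mean /slab_sd.
  transitivity (Num.sqrt tau2 ^+ 2 * u / (1 + n%:R * tau2) +
     x * (sigma * Num.sqrt tau2 / Num.sqrt (1 + n%:R * tau2))).
    by field; rewrite !gt_eqF.
  by rewrite sqr_sqrtr// ltW.
by apply/seteqP; split => x; rewrite /A /= in_itv /= key ler_pdivlMr// lerBrDl.
Qed.

Lemma integral_tilt_T (sigma tau2 u : R) (n : nat) : 0 < sigma -> 0 < tau2 ->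
  (\int[normal_prob 0 1]_x (tilt sigma u n (sigma * Num.sqrt tau2 * x)%R)%:E =
  (slab_evidence sigma tau2 u n)%:E)%E.
Proof.
move=> s0 t0.
transitivity (\int[normal_prob 0 1]_x (\1_setT x * tilt sigma u n (sigma * Num.sqrt tau2 * x)%R)%:E)%E.
  by apply: eq_integral => x _; rewrite indicT mul1r.
apply: etrans (@integral_tilt R sigma tau2 u n setT s0 t0 measurableT) _.
by rewrite [X in (_ * X)%E]probability_setT mule1.
Qed.

(** Numerator and denominator factor over groups, and the indicator of [b k <= t] affects only the
    group of [k]; all other groups cancel. *)
Lemma post_cdfE (n : nat) (X : 'I_n -> I -> R) (sigma pi0 : R) (tau2 : 'I_G -> R)
    (y : 'I_n -> R) (k : I) (t : R) (u := fun l => \sum_(i < n) X i l * y i) :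
  0 < sigma -> 0 < pi0 < 1 -> (forall g, 0 < tau2 g) ->
  (forall k l, \sum_(i < n) X i k * X i l = (k == l)%:R * n%:R) ->
  post_cdf X sigma pi0 tau2 y k t =
  mix_cdf (null_weight sigma pi0 tau2 n u (tag k))
    (slab_mean (tau2 (tag k)) (u k) n) (slab_sd sigma (tau2 (tag k)) n) t.
Proof.
move=> s0 /andP[p0 p1] t0 XX; rewrite /post_cdf.
pose C := expR (- (\sum_(i < n) y i ^+ 2) / (sigma ^+ 2 *+ 2)).
have C0 : 0 < C by exact: expR_gt0.
pose h (l : I) (b : R) := if l == k then ((b <= t)%R)%:R * tilt sigma (u l) n b
  else tilt sigma (u l) n b.
pose ev l := slab_evidence sigma (tau2 (tag l)) (u l) n.
pose Phi := std_cdf ((t - slab_mean (tau2 (tag k)) (u k) n) / slab_sd sigma (tau2 (tag k)) n).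
have hE b : (b k <= t)%R%:R * lik X sigma y b = C * \prod_l h l (b l).
  rewrite (lik_prod _ _ _ XX) mulrCA; congr (_ * _).
  rewrite (bigD1 k)//= [in RHS](bigD1 k)//= /h eqxx mulrA; congr (_ * _).
  by apply: eq_bigr => l /negbTE ->.
have -> : (fun b => ((b k <= t)%R%:R * lik X sigma y b)%:E) =
    (fun b => (C * \prod_l h l (b l))%:E) by apply/funext => b; rewrite hE.
have -> : (fun b => (lik X sigma y b)%:E) =
    (fun b => (C * \prod_l tilt sigma (u l) n (b l))%:E).
  by apply/funext => b; rewrite (lik_prod _ _ _ XX).
rewrite (@prior_exp_prod _ _ _ _ _ _ _ h (fun l => if l == k then ev l * Phi else ev l));
  [|exact: ltW| | |]; first last.
- move=> l; rewrite /h; case: (l =P k) => [->|_]; first exact: integral_tilt_le.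
  exact: integral_tilt_T.
- by move=> l b; rewrite /h; case: ifP => _; rewrite ?mulr_ge0 ?expR_ge0.
- move=> l; rewrite /h; case: (l == k); last exact: measurable_tilt.
  apply: measurable_funM; last exact: measurable_tilt.
  rewrite (_ : (fun b : R => _) = \1_(`]-oo, t]%classic : set R)); first exact: measurable_indic.
  apply/funext => b; rewrite indicE; congr (nat_of_bool _)%:R.
  by apply/idP/idP; rewrite inE /= in_itv.
rewrite (@prior_exp_prod _ _ _ _ _ _ _ (fun l => tilt sigma (u l) n) ev);
  [|exact: ltW| | |]; first last.
- by move=> l; exact: integral_tilt_T.
- by move=> l b; exact: expR_ge0.
- by move=> l; exact: measurable_tilt.
rewrite /fine -mulf_div divff ?gt_eqF// mul1r.
rewrite (bigD1 (tag k))//= [X in _ / X](bigD1 (tag k))//= -mulf_div.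
set N := (X in _ * (X / _)); set D := (X in _ * (_ / X)).
have ND : N = D.
  apply: eq_bigr => g gk; congr (_ * _ + _ * _); apply: eq_bigr => l /eqP lg.
    by case: eqP => // lk; move: gk; rewrite -lg lk eqxx.
  by rewrite /h; case: eqP => // lk; move: gk; rewrite -lg lk eqxx.
have D0 : 0 < D.
  apply: prodr_gt0 => g _; rewrite addr_gt0// mulr_gt0// ?subr_gt0//; apply: prodr_gt0 => l _.
    exact: slab_evidence_gt0.
  by rewrite tilt0.
rewrite ND divff ?gt_eqF// mulr1.
have P1 : \prod_(l : I | tag l == tag k) tilt sigma (u l) n 0 = 1.
  by rewrite big1// => l _; rewrite tilt0.
(* Under the spike the indicator is evaluated at 0, which gives the jump term of [mix_cdf]. *)
have P2 : \prod_(l : I | tag l == tag k) h l 0 = ((0 <= t)%R)%:R.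
  rewrite (bigD1 k)//= /h eqxx tilt0 mulr1 big1 ?mulr1// => l /andP[_ /negbTE ->].
  by rewrite tilt0.
have P3 : \prod_(l : I | tag l == tag k) (if l == k then ev l * Phi else ev l) =
    slab_ratio sigma tau2 n u (tag k) * Phi.
  rewrite /slab_ratio (bigD1 k)//= eqxx [in RHS](bigD1 k)//= -/(ev k) mulrAC; congr (_ * _ * _).
  by apply: eq_bigr => l /andP[_ /negbTE ->].
rewrite P1 P2 P3 /mix_cdf /null_weight -/(slab_ratio sigma tau2 n u (tag k)) -/Phi mulr1.
have := slab_ratio_gt0 sigma n u (tag k) t0.
set L := slab_ratio _ _ _ _ _ => L0.
have h0 : 0 < (1 - pi0) * L + pi0 by rewrite addr_gt0// mulr_gt0// subr_gt0.
by field; rewrite gt_eqF.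
Qed.

Lemma post_medE (n : nat) (X : 'I_n -> I -> R) (sigma pi0 : R) (tau2 : 'I_G -> R)
    (y : 'I_n -> R) :
  0 < sigma -> 0 < pi0 < 1 -> (forall g, 0 < tau2 g) ->
  (forall k l, \sum_(i < n) X i k * X i l = (k == l)%:R * n%:R) ->
  post_med X sigma pi0 tau2 y =
  median_of_score sigma pi0 tau2 n (fun l => \sum_(i < n) X i l * y i).
Proof.
move=> s0 p01 t0 XX; apply/funext => k; rewrite /post_med /median_of_score /mix_med.
congr inf; apply/seteqP; split => t /=; by rewrite post_cdfE.
Qed.

Lemma measurable_median_of_score (sigma pi0 : R) (tau2 : 'I_G -> R) (n : nat)
    d (T : measurableType d) (u : T -> I -> R) (k : I) :
  0 < sigma -> 0 < pi0 < 1 -> (forall g, 0 < tau2 g) ->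
  (forall l, measurable_fun setT (fun z => u z l)) ->
  measurable_fun setT (fun z => median_of_score sigma pi0 tau2 n (u z) k).
Proof.
move=> s0 p01 t0 mu_; have /andP[p0 p1] := p01.
apply: measurable_mix_med.
- pose L z := slab_ratio sigma tau2 n (u z) (tag k).
  have mL : measurable_fun setT L.
    rewrite /L /slab_ratio.
    under eq_fun do rewrite big_mkcond /=.
    apply: measurable_prod => l _; case: (tag l == tag k) => //.
    apply: measurable_funM => //; apply: measurableT_comp => //.
    apply: measurable_funM => //; apply: measurable_funM => //.
    exact: measurable_funX.
  (* The denominator is positive, so its inverse is written through [expR] and [ln], both
     measurable. *)
  rewrite (_ : (fun z => _) = fun z => pi0 * expR (- ln ((1 - pi0) * L z + pi0))).
    apply: measurable_funM => //; apply: measurableT_comp => //; apply: measurableT_comp => //.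
    apply: measurableT_comp; first exact: measurable_ln.
    by apply: measurable_funD => //; apply: measurable_funM.
  apply/funext => z; rewrite /null_weight -/(L z) expRN lnK// posrE.
  by rewrite addr_gt0// mulr_gt0 ?subr_gt0//; exact: slab_ratio_gt0.
- by apply: measurable_funM => //; apply: measurable_funM.
- by move=> z; have /andP[] := @null_weight_itv sigma pi0 tau2 n (u z) (tag k) p01 t0.
- by move=> z; have /andP[] := @null_weight_itv sigma pi0 tau2 n (u z) (tag k) p01 t0.
- exact: slab_sd_gt0.
Qed.

End posterior_median.

(** * Deterministic limits *)

Section asymptotics.
Context {R : realType} (G : nat) (m : 'I_G -> nat).
Local Notation I := (gcoord G m).

Section one_group.
Variable t : nat -> R.
Hypothesis t0 : forall n, 0 < t n.
Hypothesis sqrt_t : (fun n => Num.sqrt (n%:R : R) * t n) @ \oo --> +oo.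

Lemma near_nat_ge (B : R) : \forall n \near \oo, B <= n%:R.
Proof. by have /cvgryPge := @cvgr_idn R; apply. Qed.

Lemma near_sqrt_ge (B : R) : \forall n \near \oo, B <= Num.sqrt (n%:R : R).
Proof.
near=> n.
have h : B ^+ 2 <= n%:R by near: n; exact: near_nat_ge.
by apply: le_trans (ler_norm B) _; rewrite -sqrtr_sqr ler_sqrt// ler0n.
Unshelve. all: by end_near. Qed.

Lemma near_nt_ge (B : R) : \forall n \near \oo, B <= n%:R * t n.
Proof.
near=> n.
have h : Num.max B 0 <= Num.sqrt n%:R * t n.
  by near: n; move/cvgryPge : sqrt_t; apply.
have h1 : 1 <= Num.sqrt n%:R :> R by near: n; exact: near_sqrt_ge.
have -> : n%:R * t n = Num.sqrt n%:R * (Num.sqrt n%:R * t n).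
  by rewrite mulrA -expr2 sqr_sqrtr.
have hB : B <= Num.max B 0 by rewrite le_max lexx.
have h0 : 0 <= Num.max B 0 by rewrite le_max lexx orbT.
move: (Num.max B 0) (Num.sqrt n%:R * t n) (Num.sqrt n%:R : R) h h1 hB h0 => M a b h h1 hB h0.
nra.
Unshelve. all: by end_near. Qed.

(** The quotient is at most the inverse of [sqrt n * t n]. This controls the shrinkage bias, and
    divergence of [n * t n] alone would not suffice. *)
Lemma sqrt_div_cvg0 : (fun n => Num.sqrt n%:R / (1 + n%:R * t n)) @ \oo --> (0 : R).
Proof.
apply/cvgr0Pnorm_le => e e0; near=> n.
have h : e^-1 <= Num.sqrt n%:R * t n by near: n; move/cvgryPge : sqrt_t; apply.
have D0 : 0 < 1 + n%:R * t n by rewrite ltr_pwDl// mulr_ge0// ltW.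
rewrite ger0_norm; last by rewrite divr_ge0// ltW.
rewrite ler_pdivrMr//.
have E : n%:R * t n = Num.sqrt n%:R * (Num.sqrt n%:R * t n).
  by rewrite mulrA -expr2 sqr_sqrtr.
rewrite E; have s0 : 0 <= Num.sqrt n%:R :> R by [].
have h' : 1 <= e * (Num.sqrt n%:R * t n) by rewrite -ler_pdivrMl// mulr1.
move: (Num.sqrt n%:R * t n) (Num.sqrt n%:R : R) h' s0 => a b h' s0; nra.
Unshelve. all: by end_near. Qed.

Lemma inv_cvg0 : (fun n => (1 + n%:R * t n)^-1) @ \oo --> (0 : R).
Proof.
apply/cvgr0Pnorm_le => e e0; near=> n.
have h : e^-1 <= n%:R * t n by near: n; exact: near_nt_ge.
have D0 : 0 < 1 + n%:R * t n by rewrite ltr_pwDl// mulr_ge0// ltW.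
rewrite ger0_norm; last by rewrite invr_ge0 ltW.
rewrite -[leRHS]invrK lef_pV2 ?posrE ?invr_gt0//; lra.
Unshelve. all: by end_near. Qed.

Hypothesis ln_t : (fun n => ln (t n) / n%:R) @ \oo --> (0 : R).

(* The prior scale may grow, but only subexponentially, so the determinant
   factor of the marginal likelihood loses against any fixed signal. *)
Lemma near_ln_det (M c : R) : 0 <= M -> 0 < c ->
  \forall n \near \oo, M * ln (1 + n%:R * t n) <= c * n%:R.
Proof.
move=> M0 c0.
(* Chosen so that [M * a <= c / 2]; the [+ 1] covers [M = 0]. *)
pose a := c / (2 * (M + 1)).
have a0 : 0 < a by rewrite divr_gt0//; nra.
near=> n.
have n1 : 1 <= n%:R :> R by near: n; exact: near_nat_ge.
have n0 : 0 < n%:R :> R by lra.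
have nt1 : 1 <= n%:R * t n by near: n; exact: near_nt_ge.
have ltn : ln (t n) <= a * n%:R.
  rewrite -ler_pdivrMr//; apply: le_trans (ler_norm _) _.
  by near: n; move/cvgr0Pnorm_le : ln_t; apply.
(* Makes [M * (4 * sqrt n)] at most [c / 2 * n], the other half of the budget. *)
have big : 8 * (M + 1) / c <= Num.sqrt n%:R by near: n; exact: near_sqrt_ge.
have s1 : 1 <= Num.sqrt n%:R :> R by near: n; exact: near_sqrt_ge.
have sE : n%:R = Num.sqrt n%:R * Num.sqrt n%:R :> R by rewrite -expr2 sqr_sqrtr.
(* Uses [1 + n * t <= 2 * n * t] and [ln x < x] at 2 and at [sqrt n]; splitting [n] as a square
   gives [ln n] of order [sqrt n]. *)
have ln_det : ln (1 + n%:R * t n) <= 2 + 2 * Num.sqrt n%:R + ln (t n).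
  apply: (@le_trans _ _ (ln (2 * n%:R * t n))).
    rewrite ler_ln ?posrE; [nra|nra|]; by rewrite !mulr_gt0.
  rewrite !lnM ?posrE ?mulr_gt0//; apply: lerD => //.
  have sp : 0 < Num.sqrt n%:R :> R by lra.
  have lnn : ln n%:R = ln (Num.sqrt n%:R) + ln (Num.sqrt n%:R) :> R.
    by rewrite [in LHS]sE lnM.
  have l2 : ln 2 < 2 :> R by apply: ln_sublinear.
  by have := ln_sublinear sp; lra.
apply: (@le_trans _ _ (M * (4 * Num.sqrt n%:R + a * n%:R))).
  apply: ler_wpM2l => //; lra.
have aE : a * (2 * (M + 1)) = c by rewrite /a divfK//; apply/eqP; nra.
move: big; rewrite ler_pdivrMr// => big.
have h1 : M * (a * n%:R) <= c / 2 * n%:R.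
  by rewrite mulrA; apply: ler_wpM2r; [lra|nra].
have h2 : M * (4 * Num.sqrt n%:R) <= c / 2 * n%:R.
  rewrite [in leRHS]sE; move: (Num.sqrt n%:R : R) big s1 => s big s1; nra.
lra.
Unshelve. all: by end_near. Qed.

End one_group.

Variables (sigma pi0 : R) (tau2 : 'I_G -> nat -> R) (beta0 : I -> R).
Hypothesis s0 : 0 < sigma.
Hypothesis p01 : 0 < pi0 < 1.
Hypothesis t0 : forall g n, 0 < tau2 g n.
Hypothesis sqrt_t : forall g, (fun n : nat => Num.sqrt (n%:R : R) * tau2 g n) @ \oo --> +oo.
Hypothesis ln_t : forall g, (fun n : nat => ln (tau2 g n) / n%:R) @ \oo --> (0 : R).

(* [z] stands for [sqrt n] times the least squares error, so that this is the
   score vector X^T Y; for fixed [z] all limits below are deterministic. *)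
Definition score (n : nat) (z : I -> R) (k : I) : R :=
  n%:R * beta0 k + Num.sqrt n%:R * z k.

Definition med (n : nat) (z : I -> R) : I -> R :=
  median_of_score sigma pi0 (tau2^~ n) n (score n z).

(** Without signal the score is [sqrt n * x], and [n * t / (1 + n * t) <= 1] bounds the exponent
    independently of [n] and [t]; only the vanishing prefactor remains. *)
Lemma slab_evidence_null_le (t x : R) n : 0 < t ->
  slab_evidence sigma t (Num.sqrt n%:R * x) n <=
  (Num.sqrt (1 + n%:R * t))^-1 * expR (x ^+ 2 / (sigma ^+ 2 *+ 2)).
Proof.
move=> tp; have D0 : 0 < 1 + n%:R * t by rewrite ltr_pwDl// mulr_ge0// ltW.
rewrite /slab_evidence; apply: ler_wpM2l; first by rewrite invr_ge0.
rewrite ler_expR exprMn sqr_sqrtr//.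
have -> : t * (n%:R * x ^+ 2) / (sigma ^+ 2 * (1 + n%:R * t) *+ 2) =
   (n%:R * t / (1 + n%:R * t)) * (x ^+ 2 / (sigma ^+ 2 *+ 2)).
  by field; rewrite !gt_eqF.
apply: ler_piMl; first by rewrite divr_ge0 ?sqr_ge0// mulrn_wge0// sqr_ge0.
by rewrite ler_pdivrMr//; lra.
Qed.

Lemma inactive_coord g k : ~~ grp_active beta0 g -> tag k = g -> beta0 k = 0.
Proof.
move=> /existsPn /(_ k); rewrite negb_and negbK => /orP[/eqP // kg /kg//|/eqP //].
Qed.

Lemma near_inactive g z : (0 < m g)%N -> ~~ grp_active beta0 g ->
  \forall n \near \oo, forall k, tag k = g -> med n z k = 0.
Proof.
move=> mg ina; have /andP[p0 p1] := p01.
pose K := \prod_(k : I | tag k == g) expR (z k ^+ 2 / (sigma ^+ 2 *+ 2)).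
have K0 : 0 < K by apply: prodr_gt0 => k _; exact: expR_gt0.
near=> n => k kg; apply: mix_med_eq0; last exact: slab_sd_gt0; last first.
  by have /andP[] := @null_weight_itv R G m sigma pi0 (tau2^~ n) n (score n z) (tag k) p01 (t0^~ n).
rewrite kg /null_weight.
have L0 := @slab_ratio_gt0 R G m sigma (tau2^~ n) n (score n z) g (t0^~ n).
(* [L < pi0] implies [(1 - pi0) * L < pi0], that is, null weight above one half. *)
suff L : slab_ratio sigma (tau2^~ n) n (score n z) g < pi0.
  move: (slab_ratio _ _ _ _ _) L L0 => L Lp L0.
  have h : 0 < (1 - pi0) * L + pi0 by rewrite addr_gt0// mulr_gt0// subr_gt0.
  by rewrite ltr_pdivlMr//; nra.
(* One coordinate keeps its decaying prefactor, which is enough; in the others it is bounded by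
   1. *)
pose k0 : I := Tagged (fun g => 'I_(m g)) (Ordinal mg).
have kg0 : tag k0 == g by [].
have ev k' : tag k' = g -> slab_evidence sigma (tau2 (tag k') n) (score n z k') n <=
    (Num.sqrt (1 + n%:R * tau2 g n))^-1 * expR (z k' ^+ 2 / (sigma ^+ 2 *+ 2)).
  move=> k'g; rewrite /score (inactive_coord ina k'g) mulr0 add0r k'g.
  exact: slab_evidence_null_le.
have D1 : 1 <= 1 + n%:R * tau2 g n by rewrite lerDl mulr_ge0// ltW.
have q1 : 1 <= Num.sqrt (1 + n%:R * tau2 g n) by rewrite -[leLHS]sqrtr1 ler_wsqrtr.
have ev' k' : tag k' = g -> slab_evidence sigma (tau2 (tag k') n) (score n z k') n <=
    expR (z k' ^+ 2 / (sigma ^+ 2 *+ 2)).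
  move=> /ev /le_trans; apply; apply: ler_piMl; first exact: expR_ge0.
  by rewrite invf_le1// (lt_le_trans ltr01).
apply: (@le_lt_trans _ _ ((Num.sqrt (1 + n%:R * tau2 g n))^-1 * K)).
  rewrite /slab_ratio /K (bigD1 k0)//= [in leRHS](bigD1 k0)//= mulrA.
  apply: ler_pM.
  - by apply: ltW; apply: slab_evidence_gt0.
  - by apply: prodr_ge0 => k' _; apply: ltW; apply: slab_evidence_gt0.
  - exact: (ev k0 erefl).
  - apply: ler_prod => k' /andP[/eqP k'g _]; rewrite ev'// andbT.
    by apply: ltW; apply: slab_evidence_gt0.
rewrite mulrC ltr_pdivrMr ?(lt_le_trans ltr01)// mulrC -ltr_pdivrMr//.
have hD : (K / pi0 + 1) ^+ 2 <= n%:R * tau2 g n.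
  by near: n; exact: near_nt_ge.
have Kp : 0 < K / pi0 by rewrite divr_gt0.
apply: (@lt_le_trans _ _ (K / pi0 + 1)); first by rewrite ltrDl.
have -> : K / pi0 + 1 = Num.sqrt ((K / pi0 + 1) ^+ 2).
  by rewrite sqrtr_sqr gtr0_norm// addr_gt0.
by rewrite ler_wsqrtr//; lra.
Unshelve. all: by end_near. Qed.

(** The inverse square root is weakened to an inverse, as [1 + n * t >= 1], so that [near_ln_det]
    applies without square roots. *)
Lemma slab_evidence_ge (t x e : R) n : 0 < t ->
  e <= t * x ^+ 2 / (sigma ^+ 2 * (1 + n%:R * t) *+ 2) ->
  (1 + n%:R * t)^-1 * expR e <= slab_evidence sigma t x n.
Proof.
move=> tp ex; have D0 : 0 < 1 + n%:R * t by rewrite ltr_pwDl// mulr_ge0// ltW.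
have D1 : 1 <= 1 + n%:R * t by rewrite lerDl mulr_ge0// ltW.
have q0 : 0 < Num.sqrt (1 + n%:R * t) by rewrite sqrtr_gt0.
have q1 : 1 <= Num.sqrt (1 + n%:R * t) by rewrite -[leLHS]sqrtr1 ler_wsqrtr.
apply: ler_pM; rewrite ?expR_ge0 ?invr_ge0 ?(ltW D0) ?ler_expR//.
rewrite lef_pV2 ?posrE// -[leRHS](@sqr_sqrtr _ (1 + n%:R * t) (ltW D0)) expr2.
by rewrite ler_peMr// (ltW q0).
Qed.

(** One coordinate with signal gains [expR (a * n)], while each of the [M] coordinates loses at most
    a factor [1 + n * tau2]. By [near_ln_det] the total loss is at most [expR (a / 2 * n)]. *)
Lemma near_slab_ratio_ge g z B : grp_active beta0 g ->
  \forall n \near \oo, B <= slab_ratio sigma (tau2^~ n) n (score n z) g.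
Proof.
move=> /existsP[k0 /andP[kg0 bk0]].
pose b := beta0 k0; have b2 : 0 < b ^+ 2 by rewrite exprn_even_gt0.
(* The 16 is 4 from [|s * b + z k0| >= |s * b| / 2] squared, 2 from the shrinkage factor being at
   least one half, and 2 from the Gaussian exponent. *)
pose a := b ^+ 2 / (16 * sigma ^+ 2).
have a0 : 0 < a by rewrite divr_gt0// mulr_gt0// exprn_gt0.
have a20 : 0 < a / 2 by rewrite divr_gt0.
pose M : R := #|[pred k : I | tag k == g]|%:R.
have M0 : 0 <= M by exact: ler0n.
near=> n.
have n0 : 0 < n%:R :> R by rewrite (@lt_le_trans _ _ 1)//; near: n; exact: near_nat_ge.
have nt1 : 1 <= n%:R * tau2 g n by near: n; exact: near_nt_ge.
have D0 : 0 < 1 + n%:R * tau2 g n by rewrite ltr_pwDl// mulr_ge0// ltW.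
have hM : M * ln (1 + n%:R * tau2 g n) <= a / 2 * n%:R.
  by near: n; exact: (near_ln_det (t0 g) (sqrt_t g) (ln_t g) M0 a20).
have hz : 2 * `|z k0| / `|b| <= Num.sqrt n%:R by near: n; exact: near_sqrt_ge.
have hB : 2 * B / a <= n%:R by near: n; exact: near_nat_ge.
have L1 : (1 + n%:R * tau2 g n)^-1 ^+ #|[pred k : I | tag k == g]| * expR (a * n%:R) <=
    slab_ratio sigma (tau2^~ n) n (score n z) g.
  have sE : n%:R = Num.sqrt n%:R * Num.sqrt n%:R :> R by rewrite -expr2 sqr_sqrtr.
  set s := Num.sqrt n%:R in hz sE.
  have nb : 0 < `|b| by rewrite normr_gt0.
  have snn : 0 <= s by exact: sqrtr_ge0.
  have h1 : `|s * b| / 2 <= `|s * b + z k0|.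
    move: hz; rewrite ler_pdivrMr// => hz.
    by have := lerB_normD (s * b) (z k0); rewrite normrM (ger0_norm snn); lra.
  have h2 : n%:R * b ^+ 2 / 4 <= (s * b + z k0) ^+ 2.
    have -> : n%:R * b ^+ 2 / 4 = (`|s * b| / 2) ^+ 2.
      by rewrite exprMn real_normK ?num_real// sE; field.
    by rewrite -[leRHS]real_normK ?num_real// ler_sqr// nnegrE divr_ge0.
  have ex : a * n%:R <= tau2 (tag k0) n * score n z k0 ^+ 2 /
      (sigma ^+ 2 * (1 + n%:R * tau2 (tag k0) n) *+ 2).
    rewrite (eqP kg0).
    have -> : score n z k0 = s * (s * b + z k0) by rewrite mulrDr mulrA -sE.
    rewrite exprMn {1}/s sqr_sqrtr//.
    have -> : tau2 g n * (n%:R * (s * b + z k0) ^+ 2) / (sigma ^+ 2 * (1 + n%:R * tau2 g n) *+ 2) =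
      (n%:R * tau2 g n / (1 + n%:R * tau2 g n)) * ((s * b + z k0) ^+ 2 / (2 * sigma ^+ 2)).
      by field; rewrite !gt_eqF.
    have -> : a * n%:R = 2^-1 * (n%:R * b ^+ 2 / 4 / (2 * sigma ^+ 2)).
      by rewrite /a; field; rewrite gt_eqF.
    have ss : 0 < 2 * sigma ^+ 2 by rewrite mulr_gt0// exprn_gt0.
    apply: ler_pM => //.
    - by rewrite divr_ge0 ?(ltW ss)// divr_ge0// mulr_ge0// sqr_ge0.
    - by rewrite ler_pdivlMr//; lra.
    - by rewrite ler_pM2r ?invr_gt0.
  rewrite /slab_ratio -prodr_const (bigD1 k0)//= [leRHS](bigD1 k0)//= mulrAC.
  apply: ler_pM.
  - by rewrite mulr_ge0 ?expR_ge0// invr_ge0 ltW.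
  - by apply: prodr_ge0 => k _; rewrite invr_ge0 ltW.
  - by rewrite -{1}(eqP kg0); apply: slab_evidence_ge.
  - apply: ler_prod => k /andP[/eqP kg _]; rewrite invr_ge0 (ltW D0) /=.
    have := @slab_evidence_ge (tau2 (tag k) n) (score n z k) 0 n (t0 _ _).
    rewrite expR0 mulr1 kg; apply; rewrite -kg.
    apply: divr_ge0; first by rewrite mulr_ge0 ?sqr_ge0// ltW.
    by rewrite mulrn_wge0// mulr_ge0 ?sqr_ge0// addr_ge0// mulr_ge0// ltW.
apply: le_trans L1.
have -> : (1 + n%:R * tau2 g n)^-1 ^+ #|[pred k : I | tag k == g]| =
    expR (- (M * ln (1 + n%:R * tau2 g n))).
  by rewrite -mulrN (mulrC M) /M expRM_natr -lnV ?posrE// lnK ?posrE ?invr_gt0.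
rewrite -expRD; apply: le_trans (expR_ge1Dx _).
move: hB; rewrite ler_pdivrMr// => hB; lra.
Unshelve. all: by end_near. Qed.

Lemma near_null_weight_lt g z e : grp_active beta0 g -> 0 < e ->
  \forall n \near \oo, null_weight sigma pi0 (tau2^~ n) n (score n z) g < e.
Proof.
move=> ag e0; have /andP[p0 p1] := p01; near=> n.
have hL : pi0 / ((1 - pi0) * e) + 1 <= slab_ratio sigma (tau2^~ n) n (score n z) g.
  by near: n; exact: near_slab_ratio_ge.
rewrite /null_weight; move: hL; set L := slab_ratio _ _ _ _ _ => hL.
have q0 : 0 < (1 - pi0) * e by rewrite mulr_gt0// subr_gt0.
have L0 : 0 < L.
  by apply: lt_le_trans hL; rewrite ltr_pwDr// divr_ge0// ltW.
have h : 0 < (1 - pi0) * L + pi0 by rewrite addr_gt0// mulr_gt0// subr_gt0.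
have : pi0 < L * ((1 - pi0) * e).
  by rewrite -ltr_pdivrMr//; lra.
by rewrite ltr_pdivrMr// => hh; nra.
Unshelve. all: by end_near. Qed.

(** The scaled error is split at the slab mean. The first part is explicit; the second is at most
    [e], because [mix_med_close] applies with [e / sigma] and [slab_sd] is at most
    [sigma / sqrt n]. *)
Lemma med_cvg g z k : grp_active beta0 g -> tag k = g ->
  (fun n => Num.sqrt n%:R * (med n z k - beta0 k)) @ \oo --> z k.
Proof.
move=> ag kg.
pose mu n := slab_mean (tau2 (tag k) n) (score n z k) n.
have mu_cvg : (fun n => Num.sqrt n%:R * (mu n - beta0 k)) @ \oo --> z k.
  have -> : (fun n => Num.sqrt n%:R * (mu n - beta0 k)) =
    (fun n => z k - z k * (1 + n%:R * tau2 (tag k) n)^-1 -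
       beta0 k * (Num.sqrt n%:R / (1 + n%:R * tau2 (tag k) n))).
    apply/funext => n; rewrite /mu /slab_mean /score.
    have D0 : 0 < 1 + n%:R * tau2 (tag k) n by rewrite ltr_pwDl// mulr_ge0// ltW.
    have E : n%:R = Num.sqrt n%:R * Num.sqrt n%:R :> R by rewrite -expr2 sqr_sqrtr.
    transitivity ((Num.sqrt n%:R * Num.sqrt n%:R * tau2 (tag k) n) * z k / (1 + n%:R * tau2 (tag k) n)
      - beta0 k * (Num.sqrt n%:R / (1 + n%:R * tau2 (tag k) n))).
      by field; rewrite gt_eqF.
    by rewrite -E; congr (_ - _); field; rewrite gt_eqF.
  rewrite -[X in _ --> X]subr0 -[X in _ --> X - _]subr0.
  rewrite -[X in _ --> _ - X - _](mulr0 (z k)) -[X in _ --> _ - X](mulr0 (beta0 k)).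
  apply: cvgB; first apply: cvgB; first exact: cvg_cst.
    by apply: cvgMr; exact: inv_cvg0.
  by apply: cvgMr; exact: sqrt_div_cvg0.
rewrite (_ : (fun n => _) = (fun n => Num.sqrt n%:R * (mu n - beta0 k) +
    Num.sqrt n%:R * (med n z k - mu n))); last by apply/funext => n; ring.
rewrite -[X in _ --> X]addr0; apply: cvgD => //.
apply/cvgr0Pnorm_le => e e0.
have es0 : 0 < e / sigma by rewrite divr_gt0.
(* A null weight below this gap satisfies both assumptions of [mix_med_close]. *)
have dl0 : 0 < std_cdf (e / sigma) - 2^-1 by rewrite subr_gt0 std_cdf_gt_half.
near=> n.
have D0 : 0 < 1 + n%:R * tau2 (tag k) n by rewrite ltr_pwDl// mulr_ge0// ltW.
have /andP[w0 w1] := @null_weight_itv R G m sigma pi0 (tau2^~ n) n (score n z) (tag k) p01 (t0^~ n).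
have wd : null_weight sigma pi0 (tau2^~ n) n (score n z) (tag k) < std_cdf (e / sigma) - 2^-1.
  by rewrite kg; near: n; exact: near_null_weight_lt.
rewrite normrM (ger0_norm (sqrtr_ge0 _)).
apply: (@le_trans _ _ (Num.sqrt n%:R * (e / sigma * slab_sd sigma (tau2 (tag k) n) n))).
  apply: ler_wpM2l => //; apply: mix_med_close => //; first exact: slab_sd_gt0.
    have := @std_cdf_ge0 R (e / sigma); have : std_cdf (e / sigma) <= 1.
      by have := @std_cdf_ge0 R (- (e / sigma)); rewrite std_cdf_opp; lra.
    move: (null_weight _ _ _ _ _ _) (std_cdf _) w0 w1 wd => w c w0 w1 wd c1 c0; nra.
  rewrite std_cdf_opp; have : std_cdf (e / sigma) <= 1.
    by have := @std_cdf_ge0 R (- (e / sigma)); rewrite std_cdf_opp; lra.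
  move: (null_weight _ _ _ _ _ _) (std_cdf _) w0 w1 wd (dl0) => w c w0 w1 wd dlc c1; nra.
rewrite /slab_sd.
have -> : Num.sqrt n%:R * (e / sigma * (sigma * Num.sqrt (tau2 (tag k) n) / Num.sqrt (1 + n%:R * tau2 (tag k) n))) =
    e * (Num.sqrt n%:R * Num.sqrt (tau2 (tag k) n) / Num.sqrt (1 + n%:R * tau2 (tag k) n)).
  by field; rewrite !gt_eqF// sqrtr_gt0.
apply: ler_piMr; first exact: ltW.
rewrite -sqrtrM// ler_pdivrMr ?sqrtr_gt0// mul1r ler_wsqrtr//; lra.
Unshelve. all: by end_near. Qed.

Lemma near_model g z : (0 < m g)%N ->
  \forall n \near \oo, grp_active (med n z) g = grp_active beta0 g.
Proof.
move=> mg; have [ag|ina] := boolP (grp_active beta0 g); last first.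
  near=> n; apply/negbTE/existsPn => k; rewrite negb_and negbK -implybE.
  apply/implyP => /eqP kg; apply/eqP; move: (k) (kg); near: n.
  exact: near_inactive.
have /existsP[k /andP[/eqP kg bk]] := ag.
have /cvgrPdist_le cv := @med_cvg g z k ag kg.
near=> n; apply/existsP; exists k; rewrite kg eqxx /=; apply/negP => /eqP m0.
have := bk; rewrite -normr_gt0 => b0.
have : `|z k - Num.sqrt n%:R * (med n z k - beta0 k)| <= 1 by near: n; exact: cv.
(* If the median were 0, the scaled error within 1 of [z k] would give
   [sqrt n * |beta0 k| <= |z k| + 1]. *)
have big : (`|z k| + 2) / `|beta0 k| <= Num.sqrt n%:R by near: n; exact: near_sqrt_ge.
move: big; rewrite ler_pdivrMr// => big.
rewrite m0 sub0r mulrN opprK addrC => h.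
have := ler_normB (Num.sqrt n%:R * beta0 k + z k) (z k).
rewrite addrK normrM (ger0_norm (sqrtr_ge0 _)); lra.
Unshelve. all: by end_near. Qed.

End asymptotics.

(** * Transfer to the random sample *)

Section transfer.
Context {R : realType}.

(** Since [W n] and [W N] have the same law for [n >= N], the integrand may be evaluated at [W N];
    the convergence at each fixed vector then becomes convergence along a single random vector. *)
Lemma iid_normal_integral_cvg (I : finType) d (T : measurableType d) (P : probability T R)
    (W : nat -> I -> T -> R) (N : nat) (s M : R) (h : nat -> rvec I -> R) (hoo : rvec I -> R) :
  (forall n, (N <= n)%N -> iid_normal P (W n) s) ->
  (forall n, measurable_fun setT (h n)) -> measurable_fun setT hoo ->
  (forall n z, `|h n z| <= M) ->
  (forall z, (fun n => h n z) @ \oo --> hoo z) ->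
  (fun n => (\int[P]_w (h n ((W n)^~ w))%:E)%E) @ \oo -->
    (\int[P]_w (hoo ((W N)^~ w))%:E)%E.
Proof.
move=> iW mh mhoo hM hcvg.
have [mW _] := iW N (leqnn N).
have mV : measurable_fun setT (fun w => ((W N)^~ w : rvec I)) by exact: measurable_rvec.
have cvgE w : (fun n => (h n ((W N)^~ w))%:E) @ \oo --> (hoo ((W N)^~ w))%:E.
  by apply: cvg_EFin; [exact: nearW|exact: hcvg].
have [_ _ dc] := @dominated_convergence _ T R P setT measurableT
  (fun n w => (h n ((W N)^~ w))%:E) (fun w => (hoo ((W N)^~ w))%:E) (EFin \o cst M)
  (fun n => (measurable_EFinP _ _).2 (measurableT_comp (mh n) mV))
  ((measurable_EFinP _ _).2 (measurableT_comp mhoo mV))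
  (aeW _ (fun w _ => cvgE w))
  (finite_measure_integrable_cst P M measurableT)
  (aeW _ (fun w n _ => hM n _)).
apply: cvg_trans dc; apply: near_eq_cvg; near=> n.
rewrite /=; apply: esym; apply: (iid_normal_expectation _ (iW N (leqnn N)) (mh n) (hM n)).
by apply: iW; near: n; exact: nbhs_infty_ge.
Unshelve. all: by end_near. Qed.

(** The event is a union over support patterns of intersections of conditions [= 0] or [!= 0], one
    for each coordinate. *)
Lemma measurable_support_pattern (I : finType) d (T : measurableType d) (p : T -> I -> R)
    (Q : {ffun I -> bool} -> bool) : (forall k, measurable_fun setT (fun z => p z k)) ->
  measurable [set z | Q [ffun k => p z k != 0]].
Proof.
move=> mp.
pose F (q : {ffun I -> bool}) : set T := if Q q
  then \bigcap_(k in [set: I]) ((fun z => p z k) @^-1` (if q k then ~` [set 0] else [set 0]))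
  else set0.
rewrite (_ : mkset _ = \bigcup_q F q).
  apply: countable_bigcupT_measurable => // q; rewrite /F; case: ifP => // _.
  apply: bigcap_measurable_fin => k; apply: measurable_preimage => //.
  by case: (q k) => //; apply: measurableC.
apply/seteqP; split => z /=.
  move=> Qz; exists [ffun k => p z k != 0] => //; rewrite /F Qz => k _ /=; rewrite ffunE.
  by case: eqP.
move=> [q _]; rewrite /F; case: ifP => // Qq /= Fz.
rewrite (_ : [ffun k => p z k != 0] = q)//; apply/ffunP => k; rewrite ffunE.
by have := Fz k Logic.I; rewrite /=; case: (q k) => /=; [move/eqP|move=> ->; rewrite eqxx].
Qed.

End transfer.

Theorem theorem2 (R : realType) (G : nat) (m : 'I_G -> nat)
    (sigma pi0 : R) (tau2 : 'I_G -> nat -> R) (beta0 : gcoord G m -> R)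
    (X : forall n : nat, 'I_n -> gcoord G m -> R)
    (d : measure_display) (T : measurableType d) (P : probability T R)
    (eps : forall n : nat, 'I_n -> T -> R) :
  (forall g, (0 < m g)%N) ->
  0 < sigma -> 0 < pi0 < 1 ->
  (forall g n, 0 < tau2 g n) ->
  (forall n : nat, (#|gcoord G m| <= n)%N -> forall k l : gcoord G m,
      \sum_(i < n) X n i k * X n i l = (k == l)%:R * n%:R) ->
  (forall n : nat, iid_normal P (eps n) sigma) ->
  (forall g, (fun n : nat => Num.sqrt (n%:R : R) * tau2 g n) @ \oo --> +oo) ->
  (forall g, (fun n : nat => ln (tau2 g n) / n%:R) @ \oo --> (0 : R)) ->
  let Y n w := fun i : 'I_n => \sum_(k : gcoord G m) X n i k * beta0 k + eps n i w in
  let bmed n w := post_med (X n) sigma pi0 (tau2 ^~ n) (Y n w) in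
  ((fun n : nat => P [set w | forall g,
       grp_active (bmed n w) g = grp_active beta0 g]) @ \oo --> 1%E)
  /\
  (forall f : {ptws {k : gcoord G m | grp_active beta0 (tag k)} -> R} -> R,
     continuous f -> (exists M : R, forall x, `|f x| <= M) ->
     (fun n : nat => (\int[P]_w
        (f (fun k => Num.sqrt (n%:R : R) * (bmed n w (val k) - beta0 (val k))))%:E)%E)
       @ \oo --> gauss_exp sigma (fun z => (f z)%:E)).
Proof.
move=> mg s0 p01 t0 XX ieps sqrt_t ln_t Y bmed.
(* The design is orthogonal from [n = p] on; one more guarantees [n > 0], needed to divide by
   [sqrt n]. *)
pose N := #|gcoord G m|.+1.
pose W n (k : gcoord G m) (w : T) := \sum_(i < n) (X n i k / Num.sqrt n%:R) * eps n i w.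
have iW n : (N <= n)%N -> iid_normal P (W n) sigma.
  move=> Nn; apply: (@iid_normal_orthonormal R d T P (gcoord G m) 'I_n
    (fun k i => X n i k / Num.sqrt n%:R)); [exact: s0| |exact: ieps] => k l.
  have n0 : 0 < n%:R :> R by rewrite ltr0n (leq_trans _ Nn).
  transitivity ((\sum_(i < n) X n i k * X n i l) / n%:R).
    rewrite mulr_suml; apply: eq_bigr => i _; rewrite mulrACA; congr (_ * _).
    by rewrite -invfM -expr2 sqr_sqrtr// ltW.
  by rewrite (XX _ (ltnW Nn)) mulfK//; exact: lt0r_neq0.
pose psi n (z : gcoord G m -> R) := med sigma pi0 tau2 beta0 n z.
have bmedE n w : (N <= n)%N -> bmed n w = psi n ((W n)^~ w).
  move=> Nn; rewrite /bmed post_medE//; last exact: (XX _ (ltnW Nn)).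
  rewrite /psi /med; congr median_of_score; apply/funext => l.
  have n0 : 0 < n%:R :> R by rewrite ltr0n (leq_trans _ Nn).
  rewrite /score /W /Y; under eq_bigr do rewrite mulrDr.
  rewrite big_split /=; congr (_ + _); last first.
    by rewrite mulr_sumr; apply: eq_bigr => i _; field; rewrite gt_eqF// sqrtr_gt0.
  under eq_bigr do rewrite mulr_sumr; rewrite exchange_big /=.
  under eq_bigr => k _ do (under eq_bigr do rewrite mulrA; rewrite -mulr_suml (XX _ (ltnW Nn))).
  rewrite (bigD1 l)//= eqxx mul1r big1 ?addr0// => k.
  by rewrite eq_sym => /negbTE ->; rewrite !mul0r.
have mpsi n k : measurable_fun setT (fun z : rvec (gcoord G m) => psi n z k).
  apply: measurable_median_of_score => // l; apply: measurable_funD => //.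
  by apply: measurable_funM => //; exact: measurable_rvec_coord.
split.
  (* The selected model is read off the finite pattern of nonzero coordinates, so that its event is
     measurable. *)
  pose Q (q : {ffun gcoord G m -> bool}) := [forall g, [exists k, (tag k == g) && q k] == grp_active beta0 g].
  have QE (b : gcoord G m -> R) :
      Q [ffun k => b k != 0] <-> forall g, grp_active b g = grp_active beta0 g.
    split.
      move=> /forallP Qb g; rewrite -(eqP (Qb g)); apply: eq_existsb => k; by rewrite ffunE.
    move=> bg; apply/forallP => g; rewrite -bg; apply/eqP; apply: eq_existsb => k; by rewrite ffunE.
  pose h n (z : rvec (gcoord G m)) : R := (Q [ffun k => psi n z k != 0])%:R.
  have mQ n := @measurable_support_pattern R _ _ _ _ Q (mpsi n).
  have hE n : h n = \1_[set z : rvec (gcoord G m) | Q [ffun k => psi n z k != 0]].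
    by apply/funext => z; rewrite indicE /h; congr (nat_of_bool _)%:R; apply/idP/idP; rewrite inE.
  (* The probability is the expectation of an indicator that, at each fixed vector, is eventually
     the constant 1. *)
  have := @iid_normal_integral_cvg R _ _ T P W N sigma 1 h (fun=> 1) iW.
  rewrite integral_cst// [X in (_ * X)%E]probability_setT mule1 => hcvg.
  apply: cvg_trans (hcvg _ _ _ _).
  - apply: near_eq_cvg; near=> n.
    have Nn : (N <= n)%N by near: n; exact: nbhs_infty_ge.
    have [mW _] := iW n Nn.
    have mV : measurable_fun setT (fun w => ((W n)^~ w : rvec (gcoord G m))) by exact: measurable_rvec.
    pose E := [set w | Q [ffun k => psi n ((W n)^~ w) k != 0]].
    have mE : measurable E by have := mV measurableT _ (mQ n); rewrite setTI.
    have -> : [set w | forall g, grp_active (bmed n w) g = grp_active beta0 g] = E.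
      by apply/seteqP; split => w; rewrite /E /= (bmedE n w Nn) => /QE.
    transitivity (\int[P]_w (\1_E w)%:E)%E; last by rewrite integral_indic// setIT.
    apply: eq_integral => w _; rewrite indicE /h; congr (nat_of_bool _)%:R%:E.
    by apply/idP/idP; rewrite inE.
  - by move=> n; rewrite hE; exact: measurable_indic.
  - exact: measurable_cst.
  - by move=> n z; rewrite /h; case: (Q _); rewrite ?normr1 ?normr0.
  - move=> z; apply: cvg_near_cst; near=> n; rewrite /h.
    suff /QE -> : forall g, grp_active (psi n z) g = grp_active beta0 g by [].
    by near: n; apply: filter_forall => g; exact: near_model.
move=> f cf [M fM].
pose J := {k : gcoord G m | grp_active beta0 (tag k)}.
have mf := ptws_continuous_measurable cf.
pose h n (z : rvec (gcoord G m)) : R :=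
  f (fun k : J => Num.sqrt n%:R * (psi n z (val k) - beta0 (val k))).
pose hoo (z : rvec (gcoord G m)) : R := f (fun k : J => z (val k)).
have mhoo : measurable_fun setT hoo.
  apply: (measurableT_comp mf); apply: measurable_rvec => k; exact: measurable_rvec_coord.
have mh n : measurable_fun setT (h n).
  apply: (measurableT_comp mf); apply: measurable_rvec => k.
  by apply: measurable_funM => //; apply: measurable_funB.
have hcvg z : (fun n => h n z) @ \oo --> hoo z.
  apply: (cvg_comp (fun n => (fun k : J => Num.sqrt n%:R * (psi n z (val k) - beta0 (val k))) : {ptws J -> R}) f).
    by apply: ptws_cvg => k; apply: (med_cvg s0 p01 t0 sqrt_t ln_t (valP k)).
  exact: cf.
have := iid_normal_integral_cvg iW mh mhoo (fun n z => fM _) hcvg.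
(* The coordinates of [W N] in active groups are again iid normal, so the limit is a Gaussian
   expectation over these coordinates. *)
rewrite (_ : (\int[P]_w (hoo _)%:E)%E = gauss_exp sigma (fun z => (f z)%:E)); last first.
  apply: (@iid_normal_gauss_exp R J d T P (fun k => W N (val k)) sigma M f) => //.
  exact: (iid_normal_inj val_inj (iW N (leqnn N))).
apply: cvg_trans; apply: near_eq_cvg; near=> n.
have Nn : (N <= n)%N by near: n; exact: nbhs_infty_ge.
by apply: eq_integral => w _; rewrite /h (bmedE n w Nn).
Unshelve. all: by end_near. Qed.
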